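(* Let $\alpha>-1$ and $\beta>-1$ be real numbers. For real $\varepsilon\neq 0$ put $q=-e^{\varepsilon}$, $a=-e^{\varepsilon\alpha}$, $b=-e^{\varepsilon\beta}$, and let $u_n^{(\varepsilon)}=A_{n-1}C_n$ ($n\ge1$) and $b_n^{(\varepsilon)}=A_n+C_n$ ($n\ge 0$) be the recurrence coefficients of the monic little $q$-Jacobi polynomials with these parameters. Then: (i) As $\varepsilon\to0$, $u_n^{(\varepsilon)}\to u_n$ for every $n\ge1$ and $b_n^{(\varepsilon)}\to b_n$ for every $n\ge0$, where, with $\theta_n=\frac{1+(-1)^n}{2}$, $$u_n=\frac{(n+(1-\theta_n)\alpha)(n+\beta+\theta_n\alpha)}{(2n+\alpha+\beta)^2},\qquad b_n=(-1)^n\,\frac{(2n+1)\alpha+\alpha\beta+\alpha^2+(-1)^n\beta}{(2n+\alpha+\beta)(2n+2+\alpha+\beta)}$$ (for $n=0$ and $\alpha+\beta=0$ the expression for $b_0$ is read as $b_0=\frac{\alpha+1}{\alpha+\beta+2}$, to which it is equal when $\alpha+\beta\ne0$). (ii) The monic polynomials $P_n$ defined by $P_{-1}=0$, $P_0=1$, $P_{n+1}(x)+b_nP_n(x)+u_nP_{n-1}(x)=xP_n(x)$ are orthogonal on $[-1,1]$ with respect to the weight function $$w(x)=\kappa\,|x|^{\alpha}(1-x^2)^{(\beta-1)/2}(1+x),\qquad \kappa=\frac{\Gamma(\alpha/2+\beta/2+1)}{\Gamma(\beta/2+1/2)\,\Gamma(\alpha/2+1/2)},$$ whose moments $c_n=\int_{-1}^1x^nw(x)\,dx$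 are $c_0=1$ and $$c_{2n}=c_{2n-1}=\frac{(\alpha/2+1/2)_n}{(\alpha/2+\beta/2+1)_n},\qquad n=1,2,3,\dots$$ (iii) For every polynomial $f$, as $\varepsilon\to0$, $$\varepsilon^{-1}\left[a(bq-x^{-1})(f(qx)-f(x))+(1-x^{-1})(f(q^{-1}x)-f(x))\right]\longrightarrow L_0f(x),$$ where $$L_0=2(1-x)\partial_xR+(\alpha+\beta+1-\alpha x^{-1})(1-R),\qquad Rf(x)=f(-x).$$
   Context: The monic little $q$-Jacobi polynomials with parameters $a,b$ are defined by the three-term recurrence relation $P_{n+1}(x)+b_nP_n(x)+u_nP_{n-1}(x)=xP_n(x)$, $P_{-1}=0$, $P_0=1$, with $u_n=A_{n-1}C_n$, $b_n=A_n+C_n$, where $$A_n=q^n\frac{(1-aq^{n+1})(1-abq^{n+1})}{(1-abq^{2n+1})(1-abq^{2n+2})},\qquad C_n=aq^n\frac{(1-q^n)(1-bq^n)}{(1-abq^{2n+1})(1-abq^{2n})},$$ with the convention $C_0=0$. For fixed $n$ all the denominators involved are nonzero for $\varepsilon\neq0$ small enough. The symbol $(x)_n=x(x+1)\cdots(x+n-1)$ is the Pochhammer symbol. In $L_0$, $R$ is the reflection operator, $\partial_xR$ means first apply $R$ and then differentiate, and functions of $x$ act by multiplication; $L_0$ maps polynomials to polynomials. The convergence in (iii) is coefficientwise (both sides are polynomials in $x$). *)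

(* Defs.v *)
From HB Require Import structures.
From mathcomp Require Import all_boot all_order all_algebra.
From mathcomp Require Import all_classical all_reals all_analysis.
From mathcomp Require Import ring.

Set Implicit Arguments.
Unset Strict Implicit.
Unset Printing Implicit Defensive.

Import Order.TTheory GRing.Theory Num.Theory.
Import numFieldNormedType.Exports.

Local Open Scope classical_set_scope.
Local Open Scope ring_scope.

Section LittleQJacobi.
Variable R : realType.
Implicit Types (q a b x : R) (n : nat) (f p : {poly R}).

Definition qJacobiA q a b n : R :=
  q ^+ n * ((1 - a * q ^+ n.+1) * (1 - a * b * q ^+ n.+1))
  / ((1 - a * b * q ^+ (2 * n).+1) * (1 - a * b * q ^+ (2 * n).+2)).

(* The case n = 0 is set apart because the general formula may read 0 / 0
   there (namely when a * b = 1). *)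
Definition qJacobiC q a b n : R :=
  if n == 0%N then 0
  else a * q ^+ n * ((1 - q ^+ n) * (1 - b * q ^+ n))
       / ((1 - a * b * q ^+ (2 * n).+1) * (1 - a * b * q ^+ (2 * n))).

(* Meant for n >= 1 only. *)
Definition qJacobi_u q a b n : R := qJacobiA q a b n.-1 * qJacobiC q a b n.

Definition qJacobi_b q a b n : R := qJacobiA q a b n + qJacobiC q a b n.

(* f(c x) as a polynomial in x *)
Definition dilate (c : R) f : {poly R} := f \Po (c *: 'X).

(* x^-1 p(x); it is only applied to polynomials p with p(0) = 0, for which
   the division is exact (lemma mulX_divX). *)
Definition divX p : {poly R} := p %/ 'X.

(* a (b q - x^-1) (f(q x) - f(x)) + (1 - x^-1) (f(q^-1 x) - f(x)) *)
Definition qJacobi_op q a b f : {poly R} :=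
  let g := dilate q f - f in
  let h := dilate q^-1 f - f in
  a *: ((b * q) *: g - divX g) + (h - divX h).

Lemma mulX_divX p : p.[0] = 0 -> 'X * divX p = p.
Proof.
move=> p0; rewrite mulrC divpK //.
by have := dvdp_XsubCl p 0; rewrite subr0 => ->; apply/rootP.
Qed.

Lemma horner_divX p x : p.[0] = 0 -> x != 0 -> (divX p).[x] = x^-1 * p.[x].
Proof.
by move=> p0 x0; rewrite -{2}(mulX_divX p0) hornerM hornerX mulKf.
Qed.

Lemma horner_dilate c f x : (dilate c f).[x] = f.[c * x].
Proof. by rewrite horner_comp hornerZ hornerX. Qed.

Lemma horner_qJacobi_op q a b f x : x != 0 ->
  (qJacobi_op q a b f).[x] =
    a * (b * q - x^-1) * (f.[q * x] - f.[x])
    + (1 - x^-1) * (f.[q^-1 * x] - f.[x]).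
Proof.
have dil0 c : (dilate c f - f).[0] = 0.
  by rewrite hornerD hornerN horner_dilate mulr0 subrr.
move=> x0; rewrite /qJacobi_op /= !(hornerD, hornerN, hornerZ).
rewrite !horner_divX // !(hornerD, hornerN) !horner_dilate; ring.
Qed.

End LittleQJacobi.

Section LittleMinusOneJacobi.
Variable R : realType.
Implicit Types (alpha beta s x eps : R) (n : nat) (f p : {poly R}).

Definition q_ eps : R := - expR eps.
Definition a_ alpha eps : R := - expR (eps * alpha).
Definition b_ beta eps : R := - expR (eps * beta).

Definition theta n : R := (1 + (-1) ^+ n) / 2.

(* Meant for n >= 1 only. *)
Definition jacobi_u alpha beta n : R :=
  ((n%:R + (1 - theta n) * alpha) * (n%:R + beta + theta n * alpha))
  / (2 * n%:R + alpha + beta) ^+ 2.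

Definition jacobi_b alpha beta n : R :=
  if (n == 0%N) && (alpha + beta == 0) then (alpha + 1) / (alpha + beta + 2)
  else (-1) ^+ n *
    (((2 * n%:R + 1) * alpha + alpha * beta + alpha ^+ 2 + (-1) ^+ n * beta)
     / ((2 * n%:R + alpha + beta) * (2 * n%:R + 2 + alpha + beta))).

(* The pair (P_(n-1), P_n), starting from P_(-1) = 0 and P_0 = 1; the value
   u 0 plays no role. *)
Fixpoint monic_rec_pair (b u : nat -> R) n : {poly R} * {poly R} :=
  if n is m.+1 then
    let: (p', p) := monic_rec_pair b u m in
    (p, 'X * p - b m *: p - u m *: p')
  else (0, 1).

Definition monic_rec (b u : nat -> R) n : {poly R} := (monic_rec_pair b u n).2.

Definition jacobiP alpha beta : nat -> {poly R} :=
  monic_rec (jacobi_b alpha beta) (jacobi_u alpha beta).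

(* Euler's integral; s > 0 is needed for convergence. *)
Definition Gamma s : R :=
  \int[@lebesgue_measure R]_(t in `]0, +oo[) (t `^ (s - 1) * expR (- t)).

Definition pochhammer x n : R := \prod_(i < n) (x + i%:R).

Definition kappa alpha beta : R :=
  Gamma (alpha / 2 + beta / 2 + 1)
  / (Gamma (beta / 2 + 1 / 2) * Gamma (alpha / 2 + 1 / 2)).

(* 0 `^ s is 0 or 1 (never infinite) for every s; this affects w at most at
   the points -1, 0, 1, hence no integral. *)
Definition weight alpha beta x : R :=
  kappa alpha beta * `|x| `^ alpha * (1 - x ^+ 2) `^ ((beta - 1) / 2) * (1 + x).

(* Rintegral is total, so integrability is stated separately. *)
Definition orthogonal_wrt (D : set R) (w : R -> R) (P : nat -> {poly R}) : Prop :=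
  [/\ forall m n, (@lebesgue_measure R).-integrable D
        (EFin \o (fun x => (P m).[x] * (P n).[x] * w x)),
      forall m n, m != n ->
        \int[@lebesgue_measure R]_(x in D) ((P m).[x] * (P n).[x] * w x) = 0
    & forall n,
        0 < \int[@lebesgue_measure R]_(x in D) ((P n).[x] * (P n).[x] * w x)].

Definition has_moment (D : set R) (w : R -> R) n (c : R) : Prop :=
  (@lebesgue_measure R).-integrable D (EFin \o (fun x => x ^+ n * w x))
  /\ \int[@lebesgue_measure R]_(x in D) (x ^+ n * w x) = c.

Definition reflectX f : {poly R} := f \Po (- 'X).

(* In the first summand the derivative is that of the polynomial f(-x). *)
Definition L0 alpha beta f : {poly R} :=
  let g := f - reflectX f in
  2 *: ((1 - 'X) * (reflectX f)^`())
  + ((alpha + beta + 1) *: g - alpha *: divX g).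

Lemma horner_reflectX f x : (reflectX f).[x] = f.[- x].
Proof. by rewrite horner_comp hornerN hornerX. Qed.

Lemma horner_L0 alpha beta f x : x != 0 ->
  (L0 alpha beta f).[x] =
    2 * (1 - x) * (reflectX f)^`().[x]
    + (alpha + beta + 1 - alpha * x^-1) * (f.[x] - f.[- x]).
Proof.
have g0 : (f - reflectX f).[0] = 0.
  by rewrite hornerD hornerN horner_reflectX oppr0 subrr.
move=> x0; rewrite /L0 /= !(hornerD, hornerN, hornerZ, hornerM, hornerC, hornerX).
rewrite horner_divX // hornerD hornerN horner_reflectX; ring.
Qed.

End LittleMinusOneJacobi.

(* Main.v *)
(** (i) and (iii) are termwise: q ^+ n = (-1) ^+ n * expR (n eps), so every
    factor of a coefficient tends to 2 or is equivalent to a multiple of eps.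

    (ii) The limit of the q-Saalschuetz sum suggests a closed product form
    [mixed_moment] for the mixed moments L(x^j P_n), where L has the moments
    c_k.  It satisfies the recursion in n and j that the three-term recurrence
    imposes, vanishes for j < n and is positive for j = n, which is
    orthogonality.  The c_k are the moments of w by Euler's formula for the beta
    integral: Tonelli's theorem gives
    Gamma(p) Gamma(r) = Gamma(p + r) * int_0^oo v^(p-1) (1+v)^(-p-r) dv, and one
    substitutes v = x^2 / (1 - x^2). *)

Require Import Defs.
From HB Require Import structures.
From mathcomp Require Import all_boot all_order all_algebra.
From mathcomp Require Import all_classical all_reals all_analysis.
From mathcomp Require Import measurable_realfun.
From mathcomp Require Import ring lra.

Set Implicit Arguments.
Unset Strict Implicit.
Unset Printing Implicit Defensive.

Import Order.TTheory GRing.Theory Num.Theory.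
Import numFieldNormedType.Exports.

Local Open Scope classical_set_scope.
Local Open Scope ring_scope.

(** * Limits of the little q-Jacobi coefficients and operator *)

Section Limits.
Variable R : realType.
Implicit Types (alpha beta x y c eps : R) (n k : nat).

(** Two features shape the work. Signs: whether a factor of A_n or C_n tends to 2 or vanishes with
    eps depends on the parity of n, and the same alternation gives the mixed moments a product over
    one parity class of indices. Identities are therefore split by parity before algebra is applied.
    Mixed moments are used because multiplication by x merely shifts j, so a closed form for L(x^j
    P_n) can be checked against the recurrence by rational algebra alone. Singularities: t^(s-1),
    the weight and the derivative of x^2 / (1 - x^2) may blow up at an end point, and the half-line
    is unbounded. Substitution and integration by parts are performed on compact segments and then
    passed to the limit. The integrals are kept in the extended reals, where nonnegative integrands
    require no integrability; finiteness is settled for Gamma and inherited by the beta integral and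
    by the moments of the even part of the weight. *)

Lemma cvg_expRM x : expR (eps * x) @[eps --> (0 : R)^'] --> (1 : R).
Proof.
have h : expR (eps * x) @[eps --> (0 : R)] --> expR (0 * x : R).
  apply: (@continuous_comp _ _ _ (fun eps : R => eps * x) expR);
    last exact: continuous_expR.
  by apply: cvgM; [exact: cvg_id|exact: cvg_cst].
rewrite mul0r expR0 in h.
exact: cvg_within_filter h.
Qed.

Lemma cvg_expRM_slope x :
  eps^-1 * (expR (eps * x) - 1) @[eps --> (0 : R)^'] --> x.
Proof.
have [d e] : is_derive (0 : R) 1 (fun eps => expR (eps * x)) x.
  apply: is_derive_eq.
  by rewrite mul0r expR0 /GRing.scale /= !mul1r mulr1 ?mulr0 ?addr0 ?add0r.
move/cvg_ex : d => [l hl].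
have el : l = x by rewrite -e; apply/esym/cvg_lim.
rewrite el in hl; apply: cvg_trans hl; apply: near_eq_cvg; near=> t => /=.
by rewrite addr0 mul0r expR0 /GRing.scale /= mulr1.
Unshelve. all: by end_near. Qed.

(** A quotient of two difference quotients at 0; the limit is punctured, so the common factor
    [eps^-1] cancels. *)
Lemma cvg_expRM_ratio x y : y != 0 ->
  (1 - expR (eps * x)) / (1 - expR (eps * y)) @[eps --> (0 : R)^'] --> x / y.
Proof.
move=> y0.
have h : (eps^-1 * (expR (eps * x) - 1)) / (eps^-1 * (expR (eps * y) - 1))
    @[eps --> (0 : R)^'] --> x / y.
  by apply: cvgM; [|apply: cvgV => //]; exact: cvg_expRM_slope.
apply: cvg_trans h; apply: near_eq_cvg.
near=> t.
have t0 : t != 0 by near: t; exact: nbhs_dnbhs_neq.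
have eN z : t^-1 * (expR (t * z) - 1) = - t^-1 * (1 - expR (t * z)) by ring.
by rewrite !eN invfM mulrACA divff ?mul1r // oppr_eq0 invr_eq0.
Unshelve. all: by end_near. Qed.
Lemma cvg_expRM_ratio1 x y :
  (1 + expR (eps * x)) / (1 + expR (eps * y)) @[eps --> (0 : R)^'] --> (1 : R).
Proof.
have h z : 1 + expR (eps * z) @[eps --> (0 : R)^'] --> (2 : R).
  by apply: cvgD; [exact: cvg_cst|exact: cvg_expRM].
by rewrite -[X in _ --> X](@divff R 2) //; apply: cvgM; [|apply: cvgV => //]; exact: h.
Qed.

Lemma q_X eps k : q_ eps ^+ k = (-1) ^+ k * expR (eps * k%:R).
Proof. by rewrite /q_ (exprNn (expR eps)) -expRM_natl (mulrC k%:R). Qed.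

Lemma a_q_X alpha eps k :
  a_ alpha eps * q_ eps ^+ k = - (-1) ^+ k * expR (eps * (k%:R + alpha)).
Proof. by rewrite q_X /a_ mulrDr expRD; ring. Qed.

Lemma b_q_X beta eps k :
  b_ beta eps * q_ eps ^+ k = - (-1) ^+ k * expR (eps * (k%:R + beta)).
Proof. exact: a_q_X. Qed.

Lemma a_b_q_X alpha beta eps k : a_ alpha eps * b_ beta eps * q_ eps ^+ k =
  (-1) ^+ k * expR (eps * (k%:R + alpha + beta)).
Proof. by rewrite q_X /a_ /b_ !mulrDr !expRD; ring. Qed.

(** [jacobi_A] and [jacobi_C] are the limits of A_n and C_n separately; u_n and b_n are then
    recovered by rational identities. For even n it is 1 - a q^(n+1) that vanishes in A_n, for odd n
    it is 1 - a b q^(n+1). *)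
Definition jacobi_A alpha beta n : R :=
  if odd n then - ((n%:R + 1 + alpha + beta) / (2 * n%:R + 2 + alpha + beta))
  else (n%:R + 1 + alpha) / (2 * n%:R + 2 + alpha + beta).

Definition jacobi_C alpha beta n : R :=
  if n == 0%N then 0 else
  if odd n then (n%:R + beta) / (2 * n%:R + alpha + beta)
  else - (n%:R / (2 * n%:R + alpha + beta)).

(* After cancelling signs, the coefficients A_n and C_n with q, a, b of the form
   - e^(eps c) are products of this shape, for either parity of n. *)
Lemma cvg_expRM_ratios x y x' y' z : y' != 0 ->
  expR (eps * z) * ((1 + expR (eps * x)) / (1 + expR (eps * y)))
   * ((1 - expR (eps * x')) / (1 - expR (eps * y')))
    @[eps --> (0 : R)^'] --> x' / y'.
Proof.
move=> y0; rewrite -[X in _ --> X]mul1r.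
apply: cvgM; last exact: cvg_expRM_ratio.
rewrite -[X in _ --> X]mul1r.
by apply: cvgM; [exact: cvg_expRM|exact: cvg_expRM_ratio1].
Qed.

Lemma cvg_qJacobiA alpha beta n : -1 < alpha -> -1 < beta ->
  qJacobiA (q_ eps) (a_ alpha eps) (b_ beta eps) n @[eps --> (0 : R)^']
    --> jacobi_A alpha beta n.
Proof.
move=> halpha hbeta; rewrite /jacobi_A /qJacobiA.
under eq_fun do rewrite !a_q_X !a_b_q_X q_X.
rewrite -(signr_odd _ n) -(signr_odd _ n.+1) -(signr_odd _ (2 * n).+1).
rewrite -(signr_odd _ (2 * n).+2) /= !oddM /=.
have n0 : 0 <= n%:R :> R by [].
have d0 : 2 * n%:R + 2 + alpha + beta != 0 by apply: lt0r_neq0; lra.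
have e1 : (2 * n).+2%:R + alpha + beta = 2 * n%:R + 2 + alpha + beta :> R.
  by rewrite -addn2 natrD natrM.
have e2 : n.+1%:R = n%:R + 1 :> R by rewrite -addn1 natrD.
case: (odd n); rewrite /= ?expr0 ?expr1 e1 e2.
- apply: cvg_trans (cvgN (@cvg_expRM_ratios (n%:R + 1 + alpha)
    ((2 * n).+1%:R + alpha + beta) (n%:R + 1 + alpha + beta) _ n%:R d0)).
  (* [invfM] splits the inverse of the denominator into two atoms, so [ring] needs no
     nonvanishing. *)
  by apply: near_eq_cvg; near=> t;
    rewrite ?fctE /= !(mulN1r, mul1r, opprK) invfM; ring.
apply: cvg_trans (@cvg_expRM_ratios (n%:R + 1 + alpha + beta)
  ((2 * n).+1%:R + alpha + beta) (n%:R + 1 + alpha) _ n%:R d0).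
by apply: near_eq_cvg; near=> t;
    rewrite ?fctE /= !(mulN1r, mul1r, opprK) invfM; ring.
Unshelve. all: by end_near. Qed.

Lemma cvg_qJacobiC alpha beta n : -1 < alpha -> -1 < beta ->
  qJacobiC (q_ eps) (a_ alpha eps) (b_ beta eps) n @[eps --> (0 : R)^']
    --> jacobi_C alpha beta n.
Proof.
move=> halpha hbeta; rewrite /jacobi_C /qJacobiC.
have [_|n_neq0] := eqVneq n 0%N; first exact: cvg_cst.
under eq_fun do rewrite a_q_X !a_b_q_X b_q_X q_X.
rewrite -(signr_odd _ n) -(signr_odd _ (2 * n).+1).
rewrite -(signr_odd _ (2 * n)) /= !oddM /=.
have n1 : 1 <= n%:R :> R by rewrite ler1n lt0n.
have d0 : 2 * n%:R + alpha + beta != 0 by apply: lt0r_neq0; lra.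
have e1 : (2 * n)%:R + alpha + beta = 2 * n%:R + alpha + beta :> R.
  by rewrite natrM.
case: (odd n); rewrite /= ?expr0 ?expr1 e1.
- apply: cvg_trans (@cvg_expRM_ratios n%:R
    ((2 * n).+1%:R + alpha + beta) (n%:R + beta) _ (n%:R + alpha) d0).
  by apply: near_eq_cvg; near=> t;
    rewrite ?fctE /= !(mulN1r, mul1r, opprK) invfM; ring.
apply: cvg_trans (cvgN (@cvg_expRM_ratios (n%:R + beta)
  ((2 * n).+1%:R + alpha + beta) n%:R _ (n%:R + alpha) d0)).
by apply: near_eq_cvg; near=> t;
    rewrite ?fctE /= !(mulN1r, mul1r, opprK) invfM; ring.
Unshelve. all: by end_near. Qed.

(** The limits of A_(n-1) and C_n share the denominator 2 n + alpha + beta, whence the square in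
    u_n. *)
Lemma jacobi_uE alpha beta n : (1 <= n)%N -> -1 < alpha -> -1 < beta ->
  jacobi_u alpha beta n = jacobi_A alpha beta n.-1 * jacobi_C alpha beta n.
Proof.
case: n => // n _ halpha hbeta; rewrite /jacobi_u /jacobi_A /jacobi_C /theta /=.
rewrite -(signr_odd _ n.+1) /=.
have e2 : n.+1%:R = n%:R + 1 :> R by rewrite -addn1 natrD.
have n0 : 0 <= n%:R :> R by [].
rewrite e2; case: (odd n); rewrite /= ?expr0 ?expr1; field; apply: lt0r_neq0; lra.
Qed.

(** At n = 0 the numerator of b_0 factors as the product of alpha + beta and alpha + 1, so both
    branches of [jacobi_b] agree with the limit of A_0. *)
Lemma jacobi_bE alpha beta n : -1 < alpha -> -1 < beta ->
  jacobi_b alpha beta n = jacobi_A alpha beta n + jacobi_C alpha beta n.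
Proof.
move=> halpha hbeta; rewrite /jacobi_b /jacobi_A /jacobi_C.
have n0 : 0 <= n%:R :> R by [].
have [->|nN0] := eqVneq n 0%N => /=.
  have [s0|s0] := eqVneq (alpha + beta) 0.
   have -> : beta = - alpha by lra.
   rewrite !mulr0 !add0r addr0; field; apply: lt0r_neq0; lra.
  rewrite !mulr0 !add0r addr0 !expr0; field.
  by rewrite s0 andbT; apply: lt0r_neq0; lra.
rewrite -(signr_odd _ n) /=.
have n1 : 1 <= n%:R :> R by rewrite ler1n lt0n.
case: (odd n); rewrite /= ?expr0 ?expr1; field; apply/andP; split;
  apply: lt0r_neq0; lra.
Qed.

Lemma coef_dilate c (f : {poly R}) k : (dilate c f)`_k = c ^+ k * f`_k.
Proof.
rewrite /dilate coef_comp_poly.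
under eq_bigr do rewrite exprZn coefZ coefXn mulrCA.
have [kf|fk] := ltnP k (size f).
  rewrite (bigD1 (Ordinal kf)) //= eqxx mulr1 big1 ?addr0 // => i ik.
  have /negbTE -> : k != i by apply: contra ik => /eqP ki; apply/eqP/val_inj.
  by rewrite !mulr0.
rewrite big1 ?nth_default ?mulr0 // => i _.
by rewrite gtn_eqF ?mulr0 // (leq_trans (ltn_ord i)).
Qed.

Lemma coef_divX (p : {poly R}) k : p.[0] = 0 -> (divX p)`_k = p`_k.+1.
Proof. by move=> /mulX_divX pE; rewrite -[in RHS]pE coefXM. Qed.

(** Since q^-k - 1 = - (q^k - 1) q^-k, both dilations contribute a multiple of q^k - 1, and x^-1
    brings the coefficient of index k + 1 down to k: the operator is bidiagonal on monomials. *)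
Lemma coef_qJacobi_op q a b (f : {poly R}) k : q != 0 ->
  (qJacobi_op q a b f)`_k =
  (q ^+ k - 1) * (a * b * q - q ^- k) * f`_k
   - (q ^+ k.+1 - 1) * (a - q ^- k.+1) * f`_k.+1.
Proof.
have dil0 c : (dilate c f - f).[0] = 0.
  by rewrite hornerD hornerN horner_dilate mulr0 subrr.
move=> q0; rewrite /qJacobi_op !(coefD, coefN, coefZ) !coef_divX //.
rewrite !(coefD, coefN) !coef_dilate !exprVn.
have Q0 i : q ^+ i != 0 by rewrite expf_neq0.
by move: (q ^+ k) (q ^+ k.+1) (Q0 k) (Q0 k.+1) => Q Q' HQ HQ'; field; rewrite HQ' HQ.
Qed.

Lemma coef_L0 alpha beta (f : {poly R}) k : (L0 alpha beta f)`_k =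
  - (2 * k%:R * (-1) ^+ k) * f`_k - 2 * k.+1%:R * (-1) ^+ k * f`_k.+1
  + (alpha + beta + 1) * (1 - (-1) ^+ k) * f`_k
  - alpha * (1 + (-1) ^+ k) * f`_k.+1.
Proof.
have g0 : (f - reflectX f).[0] = 0.
  by rewrite hornerD hornerN horner_reflectX oppr0 subrr.
have dilE : reflectX f = dilate (-1) f by rewrite /reflectX /dilate scaleN1r.
rewrite /L0 !(coefD, coefN, coefZ) coef_divX // dilE mulrBl mul1r.
rewrite !(coefD, coefN, coefXM) coef_deriv !coef_dilate.
case: k => [|k] /=; rewrite ?coef_deriv ?coef_dilate !exprS ?expr0.
  by ring.
by ring.
Qed.

Lemma q_neq0 eps : q_ eps != 0.
Proof. by rewrite oppr_eq0 gt_eqF // expR_gt0. Qed.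

Lemma q_V eps k : q_ eps ^- k = (-1) ^+ k * expR (eps * - k%:R).
Proof. by rewrite q_X invfM -signr_odd invr_sign signr_odd mulrN expRN. Qed.

(** Both coefficients of the operator have this shape, with c = 1 + alpha + beta at index k and c =
    alpha at index k + 1. For even k the first factor is of order eps and the second tends to -2;
    for odd k the roles are exchanged. *)
Lemma cvg_qJacobi_op_factor (k : nat) c :
  eps^-1 * ((q_ eps ^+ k - 1) * (- expR (eps * c) - q_ eps ^- k))
    @[eps --> (0 : R)^'] -->
  - (1 + (-1) ^+ k) * k%:R + (1 - (-1) ^+ k) * (c + k%:R).
Proof.
under eq_fun do rewrite q_V q_X.
rewrite -(signr_odd _ k); case: (odd k); rewrite ?expr0 ?expr1.
- have h : (- expR (eps * k%:R) - 1) * (eps^-1 * (expR (eps * - k%:R) - 1)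
       - eps^-1 * (expR (eps * c) - 1)) @[eps --> (0 : R)^']
      --> (- 1 - 1) * (- k%:R - c).
    apply: cvgM; last by apply: cvgB; exact: cvg_expRM_slope.
    by apply: cvgB; [apply: cvgN; exact: cvg_expRM|exact: cvg_cst].
  rewrite (_ : - (1 + -1) * k%:R + (1 - -1) * (c + k%:R) =
    (- 1 - 1) * (- k%:R - c)); last by ring.
  by apply: cvg_trans h; apply: near_eq_cvg; near=> t => /=; ring.
have h : (eps^-1 * (expR (eps * k%:R) - 1))
     * (- expR (eps * c) - expR (eps * - k%:R)) @[eps --> (0 : R)^']
    --> (k%:R * (- 1 - 1) : R).
  apply: cvgM; first exact: cvg_expRM_slope.
  by apply: cvgB; [apply: cvgN|]; exact: cvg_expRM.
rewrite (_ : - (1 + 1) * k%:R + (1 - 1) * (c + k%:R) = k%:R * (- 1 - 1)); last by ring.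
by apply: cvg_trans h; apply: near_eq_cvg; near=> t => /=; ring.
Unshelve. all: by end_near. Qed.

Lemma cvg_qJacobi_op alpha beta (f : {poly R}) k :
  (eps^-1 *: qJacobi_op (q_ eps) (a_ alpha eps) (b_ beta eps) f)`_k
    @[eps --> (0 : R)^'] --> (L0 alpha beta f)`_k.
Proof.
have h : eps^-1 * ((q_ eps ^+ k - 1)
       * (- expR (eps * (1 + alpha + beta)) - q_ eps ^- k)) * f`_k
     - eps^-1 * ((q_ eps ^+ k.+1 - 1)
       * (- expR (eps * alpha) - q_ eps ^- k.+1)) * f`_k.+1
    @[eps --> (0 : R)^'] --> (L0 alpha beta f)`_k.
  rewrite (_ : (L0 alpha beta f)`_k =
    (- (1 + (-1) ^+ k) * k%:R + (1 - (-1) ^+ k) * (1 + alpha + beta + k%:R))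
      * f`_k
    - (- (1 + (-1) ^+ k.+1) * k.+1%:R + (1 - (-1) ^+ k.+1) * (alpha + k.+1%:R))
      * f`_k.+1); last by rewrite coef_L0 !exprS; ring.
  by apply: cvgB; apply: cvgM; [|exact: cvg_cst| |exact: cvg_cst];
    exact: cvg_qJacobi_op_factor.
apply: cvg_trans h; apply: near_eq_cvg; near=> t.
rewrite coefZ coef_qJacobi_op ?q_neq0 //.
have := a_b_q_X alpha beta t 1; rewrite expr1 => ->.
by rewrite /a_ expr1; ring.
Unshelve. all: by end_near. Qed.

End Limits.

(** * Mixed moments *)

Section MixedMoments.
Variable R : realType.
Implicit Types (alpha beta x : R) (n m j k : nat).

Lemma pochhammerS x n : pochhammer x n.+1 = pochhammer x n * (x + n%:R).
Proof. by rewrite /pochhammer big_ord_recr. Qed.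

Lemma pochhammer_gt0 x n : 0 < x -> 0 < pochhammer x n.
Proof. by move=> x0; apply: prodr_gt0 => i _; rewrite ltr_wpDr. Qed.

(** [uphalf] rounds k / 2 up, so that the indices 2 n - 1 and 2 n share one formula, which also
    covers c_0 = 1. *)
Definition jacobi_moment alpha beta k : R :=
  pochhammer (alpha / 2 + 1 / 2) (uphalf k)
  / pochhammer (alpha / 2 + beta / 2 + 1) (uphalf k).

Lemma jacobi_moment_gt0 alpha beta k : -1 < alpha -> -1 < beta ->
  0 < jacobi_moment alpha beta k.
Proof. by move=> ? ?; rewrite divr_gt0// pochhammer_gt0//; lra. Qed.

Lemma jacobi_moment0 alpha beta : jacobi_moment alpha beta 0 = 1.
Proof. by rewrite /jacobi_moment /pochhammer !big_ord0 divr1. Qed.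

Lemma jacobi_momentS alpha beta k : -1 < alpha -> -1 < beta ->
  jacobi_moment alpha beta k.+1 = jacobi_moment alpha beta k *
    (if odd k then 1 else (k%:R + alpha + 1) / (k%:R + alpha + beta + 2)).
Proof.
move=> halpha hbeta; rewrite /jacobi_moment [uphalf k]uphalf_half /=.
have [ok|ek] := boolP (odd k); first by rewrite mulr1.
rewrite add0n !pochhammerS.
have kE : k%:R = 2 * k./2%:R :> R.
  by rewrite -[in LHS](odd_double_half k) (negbTE ek) -mul2n natrM.
have k0 : 0 <= k./2%:R :> R by [].
have p0 : pochhammer (alpha / 2 + beta / 2 + 1) k./2 != 0.
  by apply: lt0r_neq0; apply: pochhammer_gt0; lra.
rewrite kE; field; rewrite p0 andbT; apply: lt0r_neq0; lra.
Qed.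

(* Up to a factor that does not depend on j, the limit as q -> -1 of the
   product of the (1 - q^(j - i)) / (1 - a b q^(j + i + 2)), i < n, which the
   q-Saalschuetz sum yields for the mixed moments of the little q-Jacobi
   polynomials. *)
Definition mixed_factor alpha beta n j : R :=
  \prod_(i < n | odd i == odd j)
     ((j%:R - i%:R) / (j%:R + i%:R + 2 + alpha + beta)).

Lemma mixed_factorS alpha beta n j :
  mixed_factor alpha beta n.+1 j = mixed_factor alpha beta n j *
    (if odd n == odd j then (j%:R - n%:R) / (j%:R + n%:R + 2 + alpha + beta)
     else 1).
Proof. by rewrite /mixed_factor big_mkcond big_ord_recr /= -big_mkcond. Qed.

(** The numerators j - i are invariant under the shift, while each denominator becomes that of the
    next index of the parity class, so the quotient telescopes to its end terms. The numerator j + 1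
    comes from the new index i = 0, which belongs to the class when j is odd. *)
Lemma mixed_factor_shift alpha beta n j : -1 < alpha -> -1 < beta ->
  mixed_factor alpha beta n.+1 j.+1 = mixed_factor alpha beta n j *
    ((if odd j then j%:R + 1 else j%:R + 2 + alpha + beta) /
     (j%:R + (if odd n == odd j then n%:R else n%:R + 1) + 2 + alpha + beta)).
Proof.
move=> halpha hbeta; have j0 : 0 <= j%:R :> R by [].
have jE : j.+1%:R = j%:R + 1 :> R by rewrite -addn1 natrD.
elim: n => [|n IHn].
  rewrite mixed_factorS /mixed_factor !big_ord0 !mul1r jE /=.
  case oj : (odd j); rewrite /= ?subr0.
    by congr (_ / _); ring.
  by rewrite addr0 divff //; apply: lt0r_neq0; lra.
rewrite mixed_factorS IHn mixed_factorS jE.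
have nE : n.+1%:R = n%:R + 1 :> R by rewrite -addn1 natrD.
have n0 : 0 <= n%:R :> R by [].
rewrite nE /=; case: (odd n); case: (odd j); rewrite /= ?mulr1 //; field;
  apply/andP; split; apply: lt0r_neq0; lra.
Qed.

Lemma mixed_factor_eq0 alpha beta n j : (j < n)%N ->
  mixed_factor alpha beta n j = 0.
Proof.
by move=> jn; rewrite /mixed_factor (bigD1 (Ordinal jn)) //= subrr !mul0r.
Qed.

Lemma mixed_factor_gt0 alpha beta n : -1 < alpha -> -1 < beta ->
  0 < mixed_factor alpha beta n n.
Proof.
move=> halpha hbeta; apply: prodr_gt0 => i /eqP oi.
have := ltn_ord i; rewrite -(ltr_nat R) => ni.
have n1 : 0 <= i%:R :> R by [].
have n2 : 1 <= n%:R :> R by rewrite ler1n (leq_trans _ (ltn_ord i)).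
apply: divr_gt0; lra.
Qed.

(** This is P_(n+1)(1) / P_n(1), so the product in [mixed_moment] is P_n(1). The constant is forced:
    as j grows, c_(j+1) / c_j and [mixed_factor] tend to 1, and the recursion for the mixed moments,
    divided by c_j, becomes the three-term recurrence at x = 1. *)
Definition mixed_ratio alpha beta n : R :=
  (if odd n then n%:R + 1 + alpha + beta else n%:R + 1 + beta)
  / (2 * n%:R + 2 + alpha + beta).

Definition mixed_moment alpha beta n j : R :=
  (\prod_(i < n) mixed_ratio alpha beta i)
  * jacobi_moment alpha beta j * mixed_factor alpha beta n j.

Lemma mixed_ratio_gt0 alpha beta n : -1 < alpha -> -1 < beta ->
  0 < mixed_ratio alpha beta n.
Proof.
move=> halpha hbeta; rewrite /mixed_ratio.
have n0 : 0 <= n%:R :> R by [].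
case: ifP => on; apply: divr_gt0; try lra.
(* For odd n the numerator n + 1 + alpha + beta is positive because n >= 1 and alpha + beta > -2. *)
by have : 1 <= n%:R :> R; [case: n on {n0} => // n _; rewrite ler1n|lra].
Qed.

Lemma mixed_moment_gt0 alpha beta n : -1 < alpha -> -1 < beta ->
  0 < mixed_moment alpha beta n n.
Proof.
move=> halpha hbeta; apply: mulr_gt0; last exact: mixed_factor_gt0.
apply: mulr_gt0; last exact: jacobi_moment_gt0.
by apply: prodr_gt0 => i _; exact: mixed_ratio_gt0.
Qed.

Lemma mixed_moment_eq0 alpha beta n j : (j < n)%N ->
  mixed_moment alpha beta n j = 0.
Proof. by move=> jn; rewrite /mixed_moment mixed_factor_eq0 ?mulr0. Qed.

Lemma mixed_moment0 alpha beta j :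
  mixed_moment alpha beta 0 j = jacobi_moment alpha beta j.
Proof. by rewrite /mixed_moment /mixed_factor !big_ord0 mul1r mulr1. Qed.

Lemma mixed_moment1 alpha beta j : -1 < alpha -> -1 < beta ->
  mixed_moment alpha beta 1 j =
  jacobi_moment alpha beta j.+1 - jacobi_b alpha beta 0 * jacobi_moment alpha beta j.
Proof.
move=> halpha hbeta; rewrite jacobi_momentS // jacobi_bE //.
rewrite /mixed_moment big_ord1 mixed_factorS /mixed_factor big_ord0.
rewrite /mixed_ratio /jacobi_A /jacobi_C /=.
have j0 : 0 <= j%:R :> R by [].
case: (odd j); rewrite /=; field; try (apply/andP; split).
all: apply: lt0r_neq0; lra.
Qed.

(** All four terms are rational multiples of the product of the first n ratios, c_j and
    [mixed_factor alpha beta n j]. Generalizing these three quantities leaves one rational identity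
    for each pair of parities of n and j. *)
Lemma mixed_momentSS alpha beta n j : -1 < alpha -> -1 < beta ->
  mixed_moment alpha beta n.+2 j = mixed_moment alpha beta n.+1 j.+1
  - jacobi_b alpha beta n.+1 * mixed_moment alpha beta n.+1 j
  - jacobi_u alpha beta n.+1 * mixed_moment alpha beta n j.
Proof.
move=> halpha hbeta; rewrite jacobi_bE // jacobi_uE //.
rewrite /mixed_moment mixed_factor_shift // jacobi_momentS // !mixed_factorS.
rewrite !big_ord_recr /=.
move: (\prod_(i < n) _) (jacobi_moment _ _ _) (mixed_factor _ _ _ _) => K c G.
rewrite /mixed_ratio /jacobi_A /jacobi_C /=.
have nE : n.+1%:R = n%:R + 1 :> R by rewrite -addn1 natrD.
have n0 : 0 <= n%:R :> R by [].
have j0 : 0 <= j%:R :> R by [].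
rewrite nE; case: (odd n); case: (odd j); rewrite /=; field.
all: repeat (apply/andP; split); apply: lt0r_neq0; lra.
Qed.

End MixedMoments.

(** * Orthogonality with respect to a linear functional with the moments c_k *)

Section OrthogonalityFromMoments.
Variable R : realType.
Implicit Types (alpha beta : R) (b u : nat -> R) (n m j : nat).

Lemma monic_recSS b u n :
  monic_rec b u n.+2 =
  'X * monic_rec b u n.+1 - b n.+1 *: monic_rec b u n.+1 - u n.+1 *: monic_rec b u n.
Proof. by rewrite /monic_rec /=; case: (monic_rec_pair b u n). Qed.

Lemma monic_rec1 b u : monic_rec b u 1 = 'X * 1 - b 0%N *: 1 - u 0%N *: 0.
Proof. by []. Qed.

Lemma size_lead_monic_rec b u n :
  size (monic_rec b u n) = n.+1 /\ (monic_rec b u n)`_n = 1.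
Proof.
have lt_size m c1 c2 (p q : {poly R}) : size p = m.+1 /\ p`_m = 1 ->
    (size q <= m.+1)%N ->
    size ('X * p - c1 *: p - c2 *: q) = m.+2 /\
    ('X * p - c1 *: p - c2 *: q)`_m.+1 = 1.
  move=> [sp pm] sq.
  have p0 : p != 0 by rewrite -size_poly_eq0 sp.
  have sXp : size ('X * p) = m.+2 by rewrite mulrC size_mulX // sp.
  have sr : (size (- (c1 *: p) - c2 *: q)%R < m.+2)%N.
    rewrite ltnS (leq_trans (size_polyD _ _)) // !size_polyN geq_max.
    by rewrite !(leq_trans (size_scale_leq _ _)) // sp.
  rewrite -addrA size_polyDl ?sXp //; split => //.
  rewrite coefD (nth_default _ (sr : (size _ <= m.+1)%N)) addr0.
  by rewrite coefXM /= pm.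
suff [] : (size (monic_rec b u n) = n.+1 /\ (monic_rec b u n)`_n = 1) /\
          (size (monic_rec b u n.+1) = n.+2 /\ (monic_rec b u n.+1)`_n.+1 = 1).
  by [].
elim: n => [|n [IH1 IH2]].
  have P0 : size (1 : {poly R}) = 1%N /\ (1 : {poly R})`_0 = 1.
    by rewrite size_poly1 coef1.
  by split; [exact: P0 | rewrite monic_rec1; apply: lt_size; rewrite ?size_poly0].
split => //; rewrite monic_recSS; apply: lt_size => //.
by rewrite IH1.1.
Qed.

(** Both sides obey the same recursion, which lowers n but raises j; hence the induction on n is
    made for all j at once. *)
Lemma functional_mixed_moment alpha beta (L : {scalar {poly R}}) n j :
  -1 < alpha -> -1 < beta ->
  (forall k, L 'X^k = jacobi_moment alpha beta k) ->
  L ('X^j * jacobiP alpha beta n) = mixed_moment alpha beta n j.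
Proof.
move=> halpha hbeta LX; rewrite /jacobiP.
elim/ltn_ind: n j => -[|[|n]] IH j.
- by rewrite mulr1 LX mixed_moment0.
- rewrite monic_rec1 scaler0 subr0 mulr1 mulrBr -exprSr -scalerAr mulr1.
  by rewrite linearB linearZ /= !LX mixed_moment1.
rewrite monic_recSS !mulrBr mulrA -exprSr -!scalerAr !linearB !linearZ /=.
by rewrite !IH // mixed_momentSS // /GRing.scale /= !mulrN.
Qed.

(** In the expansion of P_m in powers of x, every power below n is annihilated. As m <= n, at most
    the leading term x^m survives, with coefficient 1, and only when m = n. *)
Lemma functional_jacobiP_ltn alpha beta (L : {scalar {poly R}}) m n :
  -1 < alpha -> -1 < beta ->
  (forall k, L 'X^k = jacobi_moment alpha beta k) -> (m <= n)%N ->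
  L (jacobiP alpha beta m * jacobiP alpha beta n) =
  if m == n then mixed_moment alpha beta n n else 0.
Proof.
move=> halpha hbeta LX mn.
have [sm lm] := size_lead_monic_rec (jacobi_b alpha beta) (jacobi_u alpha beta) m.
rewrite -/(jacobiP alpha beta m) in sm lm.
have {1}-> : jacobiP alpha beta m =
    \sum_(i < m.+1) (jacobiP alpha beta m)`_i *: 'X^i.
  by rewrite -[LHS]coefK poly_def sm.
rewrite mulr_suml linear_sum /=.
under eq_bigr do rewrite -scalerAl linearZ /= functional_mixed_moment //.
rewrite big_ord_recr /= lm mul1r big1 ?add0r.
  by case: eqVneq => [->//|nm]; rewrite mixed_moment_eq0 // ltn_neqAle nm.
by move=> i _; rewrite mixed_moment_eq0 ?mulr0 // (leq_trans (ltn_ord i)).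
Qed.

End OrthogonalityFromMoments.

(** * The Gamma and beta integrals *)

Section SubstitutionByExhaustion.
Variable R : realType.
Notation mu := (@lebesgue_measure R).
Implicit Types (F f G : R -> R) (I J : set R).

(** Two-sided differentiability and continuity are assumed at the end points as well, and supply all
    the one-sided limits. This costs nothing here, as the segments lie inside a larger domain. *)
Lemma integration_by_substitution_is_derive F f G (a b : R) : a < b ->
  {in `[a, b] &, {homo F : x y / x < y}} ->
  (forall x, a <= x <= b -> is_derive x 1 F (f x)) ->
  (forall x, a <= x <= b -> {for x, continuous f}) ->
  (forall y, F a <= y <= F b -> {for y, continuous G}) ->
  (\int[mu]_(y in `[F a, F b]) (G y)%:E =
   \int[mu]_(x in `[a, b]) (G (F x) * f x)%:E)%E.
Proof.
move=> ab incF dF cf cG.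
have F'E x : a <= x <= b -> derive1 F x = f x.
  by move=> /dF ?; rewrite derive1E derive_val.
have cF x : a <= x <= b -> {for x, continuous F}.
  move=> /dF [? _]; exact/differentiable_continuous/derivable1_diffP.
have aab : a <= a <= b by rewrite lexx ltW.
have bab : a <= b <= b by rewrite lexx ltW.
rewrite (@integration_by_substitution_increasing R F G a b) //.
- by apply: eq_integral => x /[!inE] xab; rewrite !fctE F'E.
- exact: ltW.
- move=> x xab; have xab' : a <= x <= b.
    by move: xab; rewrite in_itv /= => /andP[/ltW-> /ltW->].
  rewrite /continuous_at F'E //; apply: cvg_trans (cf x xab'); apply: near_eq_cvg.
  near=> z; rewrite F'E //.
  have : z \in `]a, b[ by near: z; exact: near_in_itvoo.
  by rewrite in_itv /= => /andP[/ltW-> /ltW->].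
- apply/cvg_ex; exists (f a).
  apply: cvg_trans (cvg_at_right_filter (cf a aab)); apply: near_eq_cvg.
  near=> z; rewrite F'E //; apply/andP; split.
    by apply: ltW; near: z; exact: nbhs_right_gt.
  by apply: ltW; near: z; exact: nbhs_right_lt.
- apply/cvg_ex; exists (f b).
  apply: cvg_trans (cvg_at_left_filter (cf b bab)); apply: near_eq_cvg.
  near=> z; rewrite F'E //; apply/andP; split.
    by apply: ltW; near: z; exact: nbhs_left_gt.
  by apply: ltW; near: z; exact: nbhs_left_lt.
- split; [|exact: cvg_at_right_filter (cF a aab)|exact: cvg_at_left_filter (cF b bab)].
  move=> x; rewrite in_itv /= => /andP[ax xb].
  by have [] := dF x (introT andP (conj (ltW ax) (ltW xb))).
- by apply: continuous_in_subspaceT => y /[!inE]; rewrite /= in_itv /=; exact: cG.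
Unshelve. all: by end_near. Qed.

Lemma ge0_cvg_integral_exhaustion (a b : nat -> R) I (g : R -> \bar R) :
  nonincreasing_seq a -> nondecreasing_seq b -> measurable_fun I g ->
  (forall x, I x -> 0 <= g x)%E -> \bigcup_n `[a n, b n]%classic = I ->
  (\int[mu]_(x in `[a n, b n]) g x @[n --> \oo] --> \int[mu]_(x in I) g x)%E.
Proof.
move=> na nb mg g0 abI; rewrite -abI.
have sub n : `[a n, b n]%classic `<=` I by move=> x xn; rewrite -abI; exists n.
apply: ge0_nondecreasing_set_cvg_integral => //.
- move=> m n mn; apply/subsetPset => x /=; rewrite !in_itv /= => /andP[ax xb].
  by rewrite (le_trans (na _ _ mn) ax) (le_trans xb (nb _ _ mn)).
- by move=> n; apply: measurable_funS mg => //; rewrite -abI; apply: bigcup_measurable.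
- by move=> n x /sub; exact: g0.
Qed.

(** The formula holds on each segment, and by monotone convergence both sides tend to the integrals
    over J and I. Neither integral has to be finite, and nothing is asked of [f] or [G] at the ends
    of the intervals. *)
Lemma ge0_integration_by_substitution_exhaustion F f G (a b : nat -> R) I J :
  (forall n, a n < b n) -> nonincreasing_seq a -> nondecreasing_seq b ->
  \bigcup_n `[a n, b n]%classic = I -> \bigcup_n `[F (a n), F (b n)]%classic = J ->
  {in I &, {homo F : x y / x < y}} ->
  (forall x, I x -> is_derive x 1 F (f x)) ->
  (forall x, I x -> {for x, continuous f}) -> (forall x, I x -> 0 <= f x) ->
  (forall y, J y -> {for y, continuous G}) -> (forall y, J y -> 0 <= G y) ->
  (\int[mu]_(y in J) (G y)%:E = \int[mu]_(x in I) (G (F x) * f x)%:E)%E.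
Proof.
move=> ab na nb abI FabJ incF dF cf f0 cG G0.
have aI n : I (a n) by rewrite -abI; exists n; rewrite //= in_itv /= lexx ltW.
have bI n : I (b n) by rewrite -abI; exists n; rewrite //= in_itv /= lexx ltW.
have leF x y : I x -> I y -> x <= y -> F x <= F y.
  move=> Ix Iy; rewrite le_eqVlt => /predU1P[->//|xy].
  by apply/ltW/incF; rewrite ?inE.
have FIJ x : I x -> J (F x).
  move=> Ix; move: (Ix); rewrite -{1}abI => -[n _ /=].
  rewrite in_itv /= => /andP[ax xb].
  by rewrite -FabJ; exists n => //=; rewrite in_itv /= !leF.
have mI : measurable I by rewrite -abI; apply: bigcup_measurable.
have mJ : measurable J by rewrite -FabJ; apply: bigcup_measurable.
have mG : measurable_fun J G.
  apply: subspace_continuous_measurable_fun => //.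
  by apply: continuous_in_subspaceT => y /[!inE]; exact: cG.
have mGF : measurable_fun I (fun x => G (F x) * f x).
  apply: subspace_continuous_measurable_fun => //.
  apply: continuous_in_subspaceT => x /[!inE] Ix.
  apply: cvgM; last exact: cf.
  apply: (@continuous_comp _ _ _ F G); last exact/cG/FIJ.
  by have [? _] := dF x Ix; exact/differentiable_continuous/derivable1_diffP.
have cvJ : (\int[mu]_(y in `[F (a n), F (b n)]) (G y)%:E @[n --> \oo] -->
    \int[mu]_(y in J) (G y)%:E)%E.
  apply: (@ge0_cvg_integral_exhaustion (F \o a) (F \o b)) => //.
  - by move=> m n mn /=; rewrite leF // na.
  - by move=> m n mn /=; rewrite leF // nb.
  - exact/measurable_EFinP.
have cvI : (\int[mu]_(x in `[a n, b n]) (G (F x) * f x)%:E @[n --> \oo] -->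
    \int[mu]_(x in I) (G (F x) * f x)%:E)%E.
  apply: ge0_cvg_integral_exhaustion => //; first exact/measurable_EFinP.
  by move=> x Ix; rewrite lee_fin mulr_ge0 ?f0 //; exact/G0/FIJ.
apply: (cvg_unique (@ereal_hausdorff R) cvJ).
rewrite (_ : (fun n => _) = fun n =>
  (\int[mu]_(x in `[a n, b n]) (G (F x) * f x)%:E)%E) //.
apply/funext => n.
have IE x : a n <= x <= b n -> I x.
  by move=> xab; rewrite -abI; exists n => //=; rewrite in_itv.
apply: (@integration_by_substitution_is_derive F f G) => //.
- move=> x y; rewrite !in_itv /= => /IE Ix /IE Iy xy.
  by apply: incF; rewrite ?inE.
- by move=> x /IE; exact: dF.
- by move=> x /IE; exact: cf.
- by move=> y yab; apply: cG; rewrite -FabJ; exists n => //=; rewrite in_itv.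
Qed.

End SubstitutionByExhaustion.

(** * Euler's integral for Gamma: scaling, functional equation, finiteness, positivity *)

Section EulerIntegrals.
Variable R : realType.
Notation mu := (@lebesgue_measure R).
Implicit Types (s p q r c x y t : R) (n : nat).

Lemma continuous_powR_gt0 s x : 0 < x -> {for x, continuous (fun t => t `^ s)}.
Proof.
move=> x0; have [d _] := is_derive1_powR s x0.
exact/differentiable_continuous/derivable1_diffP.
Qed.

Lemma continuous_expRN x : {for x, continuous (fun t => expR (- t) : R)}.
Proof.
by apply: (@continuous_comp _ _ _ -%R expR);
  [exact: continuousN|exact: continuous_expR].
Qed.

Lemma measurable_expRN : measurable_fun [set: R] (fun t => expR (- t) : R).
Proof. by apply: measurableT_comp. Qed.

(** The index starts at 2 because the segment for 1 would reduce to the point c. *)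
Lemma bigcup_itv_pinfty c : 0 < c ->
  \bigcup_n `[c * n.+2%:R^-1, c * n.+2%:R]%classic = `]0, +oo[%classic :> set R.
Proof.
move=> c0; apply/seteqP; split => x /=.
  move=> [n _ /=]; rewrite !in_itv /= andbT => /andP[+ _].
  by apply: lt_le_trans; rewrite mulr_gt0 // invr_gt0.
rewrite in_itv /= andbT => x0.
(* Membership of x in the n-th segment means that c / x and x / c are both at most n + 2, so a bound
   of their sum serves. *)
have y0 : 0 <= c / x + x / c by rewrite addr_ge0 // divr_ge0 // ltW.
have := archi_boundP y0; set N := Num.bound _ => yN.
have yN2 : c / x + x / c < N.+2%:R by rewrite (lt_trans yN) // ltr_nat.
exists N => //=; rewrite in_itv /=; apply/andP; split.
  rewrite ler_pdivrMr // mulrC -ler_pdivrMr //.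
  by apply/ltW/(le_lt_trans _ yN2); rewrite lerDl divr_ge0 // ltW.
rewrite mulrC -ler_pdivrMr //.
by apply/ltW/(le_lt_trans _ yN2); rewrite lerDr divr_ge0 // ltW.
Qed.

Lemma nonincreasing_invn c : 0 <= c ->
  nonincreasing_seq (fun n : nat => c * n.+2%:R^-1).
Proof.
move=> c0 m n mn; rewrite ler_wpM2l // lef_pV2 ?posrE //.
by rewrite ler_nat.
Qed.

Lemma nondecreasing_natn c : 0 <= c ->
  nondecreasing_seq (fun n : nat => c * n.+2%:R).
Proof. by move=> c0 m n mn; rewrite ler_wpM2l // ler_nat. Qed.

Lemma invn_lt_natn c n : 0 < c -> c * n.+2%:R^-1 < c * n.+2%:R.
Proof.
move=> c0; rewrite ltr_pM2l // (@lt_trans _ _ 1) //.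
  by rewrite invf_lt1 // ltr1n.
by rewrite ltr1n.
Qed.

(** The extended real version lets Tonelli and the substitutions run before finiteness is known;
    [GammaE] identifies it with [Gamma] afterwards. *)
Definition eGamma s : \bar R :=
  (\int[mu]_(t in `]0%R, +oo[) (t `^ (s - 1) * expR (- t))%:E)%E.

Lemma measurable_gamma_integrand s (D : set R) :
  measurable_fun D (fun t => (t `^ (s - 1) * expR (- t))%:E).
Proof.
apply/measurable_EFinP; apply: measurable_funTS.
by apply: measurable_funM; [exact: measurable_powR|exact: measurable_expRN].
Qed.

Lemma gamma_integrand_ge0 s t : 0 <= t `^ (s - 1) * expR (- t).
Proof. by rewrite mulr_ge0 ?powR_ge0 ?expR_ge0. Qed.

Lemma continuous_gamma_integrand s x : 0 < x ->
  {for x, continuous (fun t => t `^ (s - 1) * expR (- t))}.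
Proof.
by move=> x0; apply: cvgM; [exact: continuous_powR_gt0|exact: continuous_expRN].
Qed.

Lemma eGamma_ge0 s : (0 <= eGamma s)%E.
Proof. by apply: integral_ge0 => t _; rewrite lee_fin gamma_integrand_ge0. Qed.

(** The substitution of c t for t. It evaluates the inner integrals of [eGammaM], once with c = t
    and once with c = 1 + v. *)
Lemma eGamma_scale c s : 0 < c ->
  (\int[mu]_(t in `]0%R, +oo[) (t `^ (s - 1) * expR (- (c * t)))%:E
   = (c `^ (- s))%:E * eGamma s)%E.
Proof.
move=> c0.
have cs0 : c `^ s != 0 by rewrite gt_eqF // powR_gt0.
have -> : eGamma s = ((c `^ s)%:E *
    \int[mu]_(t in `]0%R, +oo[) (t `^ (s - 1) * expR (- (c * t)))%:E)%E.
  rewrite -ge0_integralZl //; last 3 first.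
  - apply/measurable_EFinP; apply: measurable_funTS.
    apply: measurable_funM; first exact: measurable_powR.
    by apply: measurableT_comp => //; apply: measurableT_comp.
  - by move=> t _; rewrite lee_fin mulr_ge0 ?powR_ge0 ?expR_ge0.
  - by rewrite lee_fin powR_ge0.
  transitivity (\int[mu]_(t in `]0%R, +oo[)
      ((c * t) `^ (s - 1) * expR (- (c * t)) * c)%:E)%E; last first.
    apply: eq_integral => t; rewrite inE /= in_itv /= andbT => t0.
    rewrite powRM ?ltW // -EFinM; congr EFin.
    have -> : c `^ s = c * c `^ (s - 1).
      rewrite -[in RHS](powRr1 (ltW c0)) -powRrM mul1r -powRD ?subrKC //.
      by rewrite (gt_eqF c0) implybT.
    by ring.
  apply: (@ge0_integration_by_substitution_exhaustion R ( *%R c) (cst c)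
    (fun t => t `^ (s - 1) * expR (- t)) (fun n => 1 * n.+2%:R^-1)
    (fun n => 1 * n.+2%:R) `]0, +oo[%classic `]0, +oo[%classic).
  - by move=> n; exact: invn_lt_natn.
  - exact: nonincreasing_invn.
  - exact: nondecreasing_natn.
  - exact: bigcup_itv_pinfty.
  - by under eq_bigcupr do rewrite !mul1r; exact: bigcup_itv_pinfty.
  - by move=> x y _ _ xy; rewrite ltr_pM2l.
  - by move=> x _; apply: is_derive_eq; rewrite /GRing.scale /= mulr1.
  - by move=> x _; exact: cst_continuous.
  - by move=> x _; exact: ltW.
  - move=> x /=; rewrite in_itv /= andbT => x0.
    exact: continuous_gamma_integrand.
  - by move=> x _; exact: gamma_integrand_ge0.
rewrite muleA -EFinM powRN mulVf // mul1e //.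
Qed.

Lemma is_derive_NexpRN x : is_derive x 1 (fun t => - expR (- t)) (expR (- x)).
Proof. by apply: is_derive_eq; rewrite /GRing.scale /=; ring. Qed.

Lemma eGamma1 : eGamma 1 = 1%E.
Proof.
rewrite /eGamma integral_itv_obnd_cbnd; last exact: measurable_gamma_integrand.
transitivity (\int[mu]_(t in `[0%R, +oo[) (expR (- t))%:E)%E.
  by apply: eq_integral => t _; rewrite subrr powRr0 mul1r.
rewrite (@ge0_continuous_FTC2y R _ (fun t => - expR (- t)) 0 0).
- by rewrite oppr0 expR0 -EFinB opprK add0r.
- by move=> x _; exact: expR_ge0.
- by apply: continuous_subspaceT => x; exact: continuous_expRN.
- by rewrite -oppr0; apply: cvgN; exact: cvgr_expR.
- by move=> x _; have [] := is_derive_NexpRN x.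
- apply: cvg_at_right_filter; apply: cvgN; exact: continuous_expRN.
- by move=> x _; rewrite derive1E; have [_ ->] := is_derive_NexpRN x.
Qed.

Lemma cvg_boundary_0 s (u : nat -> R) : 0 < s -> (forall n, 0 < u n) ->
  u n @[n --> \oo] --> (0 : R) ->
  u n `^ s * expR (- u n) @[n --> \oo] --> (0 : R).
Proof.
move=> s0 u0 cu.
have /cvg_at_rightP h := powR_cvg0 s0.
apply: (@squeeze_cvgr _ _ _ _ (cst 0) (fun n => u n `^ s)).
- near=> n; rewrite mulr_ge0 ?powR_ge0 ?expR_ge0 //= ler_piMr ?powR_ge0 //.
  by rewrite -[leRHS]expR0 ler_expR oppr_le0 ltW.
- exact: cvg_cst.
- by apply: h; split.
Unshelve. all: by end_near. Qed.

Lemma cvg_boundary_pinfty s (u : nat -> R) : 0 < s -> (forall n, 0 < u n) ->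
  u n @[n --> \oo] --> +oo ->
  u n `^ s * expR (- u n) @[n --> \oo] --> (0 : R).
Proof.
move=> s0 u0 cu.
(* K = (2 s)^s. From ln y < y at y = u / (2 s) one gets s ln u <= s ln (2 s) + u / 2, hence u^s
   e^(-u) <= K e^(-u/2). *)
pose K := expR (s * ln (2 * s)).
apply: (@squeeze_cvgr _ _ _ _ (cst 0) (fun n => K * expR (- (2^-1 * u n)))).
- near=> n; rewrite mulr_ge0 ?powR_ge0 ?expR_ge0 //=.
  rewrite /powR gt_eqF ?u0 // /K -!expRD ler_expR.
  have s2 : 0 < 2 * s by rewrite mulr_gt0.
  have us : 0 < u n / (2 * s) by rewrite divr_gt0 ?u0.
  have /ltW := ln_sublinear us.
  have -> : ln (u n) = ln (2 * s) + ln (u n / (2 * s)).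
    by rewrite -lnM ?posrE // mulrC divfK // gt_eqF.
  rewrite -(ler_pM2l s0).
  have -> : s * (u n / (2 * s)) = 2^-1 * u n by field; rewrite gt_eqF.
  rewrite mulrDr; lra.
- exact: cvg_cst.
- rewrite -[X in _ --> X](mulr0 K); apply: cvgM; first exact: cvg_cst.
  have cu2 : 2^-1 * u n @[n --> \oo] --> +oo.
    apply/cvgryPge => M; near=> n; rewrite ler_pdivlMl //.
    by near: n; move/cvgryPge : cu; exact.
  exact: (cvg_comp _ _ cu2 (@cvgr_expR R)).
Unshelve. all: by end_near. Qed.

Lemma cvg_invn : (1 * n.+2%:R^-1 : R) @[n --> \oo] --> (0 : R).
Proof.
under eq_fun do rewrite mul1r.
have := @cvg_harmonic R; rewrite -(@cvg_shiftS R (@harmonic R)).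
exact.
Qed.

Lemma cvg_natn : (1 * n.+2%:R : R) @[n --> \oo] --> +oo.
Proof.
apply/cvgryPge => M; near=> n; rewrite mul1r.
apply: (@le_trans _ _ n%:R); last by rewrite ler_nat ltnW // ltnW.
by near: n; exact: nbhs_infty_ger.
Unshelve. all: by end_near. Qed.

Lemma integral_gamma_by_parts s (a b : R) : 0 < a -> a < b ->
  (\int[mu]_(t in `[a, b]) (t `^ (s + 1 - 1) * expR (- t))%:E =
   (a `^ s * expR (- a) - b `^ s * expR (- b))%:E
   + s%:E * \int[mu]_(t in `[a, b]) (t `^ (s - 1) * expR (- t))%:E)%E.
Proof.
move=> a0 ab.
have gt0 x : a <= x -> 0 < x by exact: lt_le_trans.
have cp r : {within `[a, b], continuous (fun t : R => t `^ r)}.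
  apply: continuous_in_subspaceT => x /[!inE] /=; rewrite in_itv /=.
  by move=> /andP[/gt0 x0 _]; exact: continuous_powR_gt0.
have ce : {within `[a, b], continuous (fun t : R => expR (- t))}.
  by apply: continuous_subspaceT => x; exact: continuous_expRN.
transitivity (\int[mu]_(t in `[a, b]) (t `^ s * expR (- t))%:E)%E.
  by apply: eq_integral => t _; rewrite addrK.
rewrite (@integration_by_parts R (fun t => t `^ s) (fun t => - expR (- t))
  (fun t => s * t `^ (s - 1)) (fun t => expR (- t))) //.
- rewrite !mulrN opprK [X in X%:E + _ = _]addrC; congr (_ + _)%E.
  transitivity (- ((- s)%:E *
      \int[mu]_(t in `[a, b]) (t `^ (s - 1) * expR (- t))%:E))%E.
    rewrite -integralZl //; last first.
      apply: continuous_compact_integrable; first exact: segment_compact.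
      apply: continuous_in_subspaceT => x /[!inE] /=; rewrite in_itv /=.
      by move=> /andP[/gt0 x0 _]; exact: continuous_gamma_integrand.
    by congr (- _)%E; apply: eq_integral => t _; rewrite -EFinM; congr EFin; ring.
  by rewrite EFinN mulNe oppeK.
- apply: continuous_in_subspaceT => x /[!inE] /=; rewrite in_itv /=.
  move=> /andP[/gt0 x0 _]; apply: cvgM; first exact: cvg_cst.
  exact: continuous_powR_gt0.
- split.
  + move=> x; rewrite in_itv /= => /andP[/ltW /gt0 x0 _].
    by have [] := is_derive1_powR s x0.
  + by apply: cvg_at_right_filter; exact: continuous_powR_gt0.
  + by apply: cvg_at_left_filter; apply: continuous_powR_gt0; exact: lt_trans ab.
- move=> x; rewrite in_itv /= => /andP[/ltW /gt0 x0 _].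
  by rewrite derive1E; have [_ ->] := is_derive1_powR s x0.
- split.
  + by move=> x _; have [] := is_derive_NexpRN x.
  + by apply: cvg_at_right_filter; apply: cvgN; exact: continuous_expRN.
  + by apply: cvg_at_left_filter; apply: cvgN; exact: continuous_expRN.
- by move=> x _; rewrite derive1E; have [_ ->] := is_derive_NexpRN x.
Qed.

(** Integration by parts on the segments from 1 / (n + 2) to n + 2; the boundary terms t^s e^(-t)
    vanish at both ends as n grows, at 0 because s > 0. *)
Lemma eGammaS s : 0 < s -> eGamma (s + 1) = (s%:E * eGamma s)%E.
Proof.
move=> s0.
pose a n : R := 1 * n.+2%:R^-1; pose b n : R := 1 * n.+2%:R.
have cv r : (\int[mu]_(t in `[a n, b n]) (t `^ (r - 1) * expR (- t))%:E
    @[n --> \oo] --> eGamma r)%E.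
  apply: ge0_cvg_integral_exhaustion.
  - exact: nonincreasing_invn.
  - exact: nondecreasing_natn.
  - exact: measurable_gamma_integrand.
  - by move=> x _; rewrite lee_fin gamma_integrand_ge0.
  - exact: bigcup_itv_pinfty.
apply: (cvg_unique (@ereal_hausdorff R) (cv (s + 1))).
have a0 n : 0 < a n by rewrite /a mul1r.
have b0 n : 0 < b n by rewrite /b mul1r.
have h : ((a n `^ s * expR (- a n) - b n `^ s * expR (- b n))%:E
   + s%:E * \int[mu]_(t in `[a n, b n]) (t `^ (s - 1) * expR (- t))%:E
   @[n --> \oo] --> 0%:E + s%:E * eGamma s)%E.
  apply: cvgeD.
  - by [].
  - apply: cvg_EFin; first by near=> n.
    rewrite -[X in _ --> X]subr0; apply: cvgB.
      by apply: cvg_boundary_0 => //; exact: cvg_invn.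
    by apply: cvg_boundary_pinfty => //; exact: cvg_natn.
  - by apply: cvgeZl => //; exact: cv.
rewrite add0e in h; apply: cvg_trans h; apply: near_eq_cvg; near=> n.
rewrite -integral_gamma_by_parts //; exact: invn_lt_natn.
Unshelve. all: by end_near. Qed.

Lemma eGamma_nat_fin n : eGamma n.+1%:R \is a fin_num.
Proof.
elim: n => [|n IHn]; first by rewrite eGamma1.
by rewrite -[X in eGamma X]natr1 eGammaS // fin_numM.
Qed.

(** For r >= 1, t^(r-1) is at most 1 when t <= 1 and at most t^(N+1) when t > 1, so Gamma(r) is
    bounded by Gamma(1) + Gamma(N + 2), which is finite by the functional equation. *)
Lemma eGamma_fin s : 0 < s -> eGamma s \is a fin_num.
Proof.
have ge1 r : 1 <= r -> eGamma r \is a fin_num.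
  move=> r1; rewrite ge0_fin_numE ?eGamma_ge0 //.
  set N := Num.bound r.
  have rN : r < N.+2%:R.
    have := archi_boundP (le_trans ler01 r1); rewrite -/N => rN.
    by rewrite (lt_trans rN) // ltr_nat.
  apply: (@le_lt_trans _ _ (eGamma 1 + eGamma N.+2%:R)); last first.
    by rewrite lte_add_pinfty // ltey_eq ?eGamma1 // eGamma_nat_fin.
  have m0 x := @measurable_gamma_integrand x `]0, +oo[%classic.
  have g0 x t : `]0, +oo[%classic t -> (0 <= (t `^ (x - 1) * expR (- t))%:E)%E.
    by rewrite lee_fin gamma_integrand_ge0.
  have le_integrand t : 0 < t -> ((t `^ (r - 1) * expR (- t))%:E <=
      (t `^ (1 - 1) * expR (- t))%:E + (t `^ (N.+2%:R - 1) * expR (- t))%:E)%E.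
    move=> t0.
    rewrite lee_fin -mulrDl ler_wpM2r ?expR_ge0 // subrr powRr0.
    have [t1|t1] := leP t 1.
      rewrite ler_wpDr ?powR_ge0 //.
      apply: (@le_trans _ _ (1 `^ (r - 1))); last by rewrite powR1.
      by apply: ge0_ler_powR; rewrite ?nnegrE ?subr_ge0 // ltW.
    rewrite ler_wpDl // ler_powR ?(ltW t1) // lerD2r ltW //.
  rewrite /eGamma -ge0_integralD //; do ?[exact: m0 | by move=> t; exact: g0].
  apply: ge0_le_integral; rewrite //=.
  - by move=> t; exact: g0.
  - exact: m0.
  - by apply: emeasurable_funD; exact: m0.
  move=> t; rewrite inE => tD; apply: le_integrand.
  by have : (t : R) \in `]0, +oo[ := tD; rewrite in_itv /= andbT.
(* Any s > 0 reduces to s + 1 >= 1: if Gamma(s) were infinite, so would be s Gamma(s) = Gamma(s +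
   1). *)
move=> s0; have := ge1 (s + 1); rewrite lerDr ltW // => /(_ isT).
rewrite eGammaS // => h.
by move: h; case: (eGamma s) (eGamma_ge0 s) => //; rewrite gt0_muley ?lte_fin.
Qed.

Lemma eGamma_gt0 s : (0 < eGamma s)%E.
Proof.
(* A lower bound of the integrand on the segment from 1 to 2, where 0 <= ln t <= 2 and e^(-t) >=
   e^(-2). *)
pose c := expR (- (2 * `|s - 1|) - 2).
apply: (@lt_le_trans _ _ (\int[mu]_(t in `[1%R, 2%R]) (cst c%:E t))%E).
  rewrite integral_cst //= lebesgue_measure_itv /= lte_fin ltr1n /=.
  by rewrite -EFinD -EFinM lte_fin mulr_gt0 ?expR_gt0 // subr_gt0 ltr1n.
apply: (@le_trans _ _
    (\int[mu]_(t in `[1%R, 2%R]) (t `^ (s - 1) * expR (- t))%:E)%E).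
  apply: ge0_le_integral => //.
  - by move=> t _; rewrite lee_fin expR_ge0.
  - exact: measurable_gamma_integrand.
  move=> t /=; rewrite in_itv /= => /andP[t1 t2].
  have t0 : 0 < t by exact: lt_le_trans t1.
  rewrite lee_fin /c expRD ler_pM ?expR_ge0 //; last by rewrite ler_expR lerN2.
  rewrite /powR gt_eqF // ler_expR.
  have l0 : 0 <= ln t by rewrite ln_ge0.
  have l2 : ln t <= 2 by rewrite (le_trans (ltW (ln_sublinear t0))).
  have := ler_norm (- ((s - 1) * ln t)); rewrite normrN normrM (ger0_norm l0).
  have : `|s - 1| * ln t <= `|s - 1| * 2 by rewrite ler_wpM2l.
  lra.
apply: ge0_subset_integral => //.
- exact: measurable_gamma_integrand.
- by move=> t _; rewrite lee_fin gamma_integrand_ge0.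
- move=> t /=; rewrite !in_itv /= andbT => /andP[t1 _].
  exact: lt_le_trans t1.
Qed.

Lemma GammaE s : 0 < s -> (Gamma s)%:E = eGamma s.
Proof. by move=> s0; rewrite /Gamma /Rintegral fineK // eGamma_fin. Qed.

Lemma Gamma_gt0 s : 0 < s -> 0 < Gamma s.
Proof. by move=> s0; rewrite -lte_fin GammaE // eGamma_gt0. Qed.

Lemma GammaS s : 0 < s -> Gamma (s + 1) = s * Gamma s.
Proof.
by move=> s0; apply: EFin_inj; rewrite EFinM !GammaE ?addr_gt0 // eGammaS.
Qed.

End EulerIntegrals.

(** * The beta integral *)

Section BetaIntegral.
Variable R : realType.
Notation mu := (@lebesgue_measure R).
Implicit Types (p r x y t : R).

(** Tonelli on the whole plane, applied to [h] extended by 0 outside the rectangle. *)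
Lemma fubini_tonelli_setX (D E : set R) (h : R * R -> R) :
  measurable D -> measurable E -> measurable_fun setT h ->
  (forall z, 0 <= h z) ->
  (\int[mu]_(x in D) \int[mu]_(y in E) (h (x, y))%:E =
   \int[mu]_(y in E) \int[mu]_(x in D) (h (x, y))%:E)%E.
Proof.
move=> mD mE mh h0.
pose f := (EFin \o h) \_ (D `*` E).
have mf : measurable_fun setT f.
  apply/(measurable_restrictT _ _).1; first exact: measurableX.
  by apply: measurable_funTS; exact/measurable_EFinP.
have f0 z : (0 <= f z)%E by apply: erestrict_ge0 => ? _; rewrite lee_fin.
have := @fubini_tonelli _ _ _ _ R mu mu f mf f0.
have fE x y : f (x, y) = if (x \in D) && (y \in E) then (h (x, y))%:E else 0%E.
  by rewrite /f patchE in_setX.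
under eq_integral => x _.
  rewrite (_ : (\int[mu]_y f (x, y))%E =
    ((fun x => \int[mu]_(y in E) (h (x, y))%:E) \_ D) x)%E; last first.
    rewrite patchE; case: ifPn => xD.
      rewrite [RHS]integral_mkcond; apply: eq_integral => y _.
      by rewrite fE xD patchE.
    by apply: integral0_eq => y _; rewrite fE (negbTE xD).
  over.
rewrite -integral_mkcond => ->.
under eq_integral => y _.
  rewrite (_ : (\int[mu]_x f (x, y))%E =
    ((fun y => \int[mu]_(x in D) (h (x, y))%:E) \_ E) y)%E; last first.
    rewrite patchE; case: ifPn => yE.
      rewrite [RHS]integral_mkcond; apply: eq_integral => x _.
      by rewrite fE yE andbT patchE.
    by apply: integral0_eq => x _; rewrite fE (negbTE yE) andbF.
  over.
by rewrite -integral_mkcond.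
Qed.

Lemma powR_expR x r : 0 < x -> x `^ r = expR (r * ln x).
Proof. by move=> x0; rewrite /powR gt_eqF. Qed.

(* The substitution t = s v turns Gamma(p) Gamma(r) into a double integral in
   which s and v can be exchanged. *)
Lemma eGammaM p r : 0 < p -> 0 < r ->
  (eGamma p * eGamma r = eGamma (p + r) *
    \int[mu]_(v in `]0%R, +oo[) (v `^ (p - 1) * (1 + v) `^ (- (p + r)))%:E)%E.
Proof.
move=> p0 r0.
(* Here [z.1] is s and [z.2] is v. Integrating over v first leaves Gamma(p) s^(r-1) e^(-s);
   integrating over s first leaves Gamma(p + r) v^(p-1) (1+v)^(-p-r). *)
pose h (z : R * R) :=
  z.1 `^ (p + r - 1) * z.2 `^ (p - 1) * expR (- ((1 + z.2) * z.1)).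
have mh : measurable_fun setT h.
  apply: measurable_funM; first apply: measurable_funM.
  - exact: measurableT_comp (measurable_powR _) measurable_fst.
  - exact: measurableT_comp (measurable_powR _) measurable_snd.
  - apply: measurableT_comp => //; apply: measurableT_comp => //.
    apply: measurable_funM => //.
    exact: measurable_funD.
have h0 z : 0 <= h z by rewrite !mulr_ge0 ?powR_ge0 ?expR_ge0.
have mI : measurable (`]0%R, +oo[%classic : set R) by [].
have := fubini_tonelli_setX mI mI mh h0.
have -> : (\int[mu]_(x in `]0%R, +oo[) \int[mu]_(y in `]0%R, +oo[) (h (x, y))%:E
   = eGamma p * eGamma r)%E.
  rewrite -ge0_integralZl //; last 3 first.
  - exact: measurable_gamma_integrand.
  - by move=> t _; rewrite lee_fin gamma_integrand_ge0.
  - exact: eGamma_ge0.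
  apply: eq_integral => t; rewrite inE /= in_itv /= andbT => t0.
  transitivity (\int[mu]_(y in `]0%R, +oo[) ((t `^ (p + r - 1) * expR (- t))%:E *
     (y `^ (p - 1) * expR (- (t * y)))%:E))%E.
    apply: eq_integral => y _; rewrite -EFinM; congr EFin.
    by rewrite /h /= mulrDl mul1r opprD expRD [y * t]mulrC; ring.
  rewrite ge0_integralZl //; last 3 first.
  - apply/measurable_EFinP; apply: measurable_funTS.
    apply: measurable_funM; first exact: measurable_powR.
    by apply: measurableT_comp => //; apply: measurableT_comp.
  - by move=> y _; rewrite lee_fin mulr_ge0 ?powR_ge0 ?expR_ge0.
  - by rewrite lee_fin mulr_ge0 ?powR_ge0 ?expR_ge0.
  rewrite eGamma_scale // muleA -EFinM muleC; congr (_ * _%:E)%E.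
  rewrite mulrAC; congr (_ * _); rewrite !powR_expR // -expRD; congr expR; ring.
move=> ->; rewrite -ge0_integralZl //; last 3 first.
- apply/measurable_EFinP; apply: measurable_funTS.
  apply: measurable_funM; first exact: measurable_powR.
  by apply: measurableT_comp (measurable_powR _) _; exact: measurable_funD.
- by move=> t _; rewrite lee_fin mulr_ge0 ?powR_ge0.
- exact: eGamma_ge0.
apply: eq_integral => v; rewrite inE /= in_itv /= andbT => v0.
transitivity (\int[mu]_(x in `]0%R, +oo[) ((v `^ (p - 1))%:E *
   (x `^ (p + r - 1) * expR (- ((1 + v) * x)))%:E))%E.
  by apply: eq_integral => x _; rewrite -EFinM; congr EFin; rewrite /h /=; ring.
rewrite ge0_integralZl //; last 3 first.
- apply/measurable_EFinP; apply: measurable_funTS.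
  apply: measurable_funM; first exact: measurable_powR.
  by apply: measurableT_comp => //; apply: measurableT_comp.
- by move=> y _; rewrite lee_fin mulr_ge0 ?powR_ge0 ?expR_ge0.
- by rewrite lee_fin powR_ge0.
by rewrite eGamma_scale ?addr_gt0 // muleA -EFinM muleC.
Qed.

(** The index starts at 3 because the segment for 2 would reduce to the point 1 / 2. *)
Lemma bigcup_itv_01 :
  \bigcup_n `[n.+3%:R^-1, 1 - n.+3%:R^-1]%classic = `]0, 1[%classic :> set R.
Proof.
apply/seteqP; split => x /=.
  move=> [n _ /=]; rewrite !in_itv /= => /andP[nx xn].
  apply/andP; split; first by rewrite (lt_le_trans _ nx) // invr_gt0.
  by rewrite (le_lt_trans xn) // gtrBl invr_gt0.
rewrite in_itv /= => /andP[x0 x1].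
have x10 : 0 < 1 - x by rewrite subr_gt0.
have y0 : 0 <= x^-1 + (1 - x)^-1 by rewrite addr_ge0 // invr_ge0 ltW.
have := archi_boundP y0; set N := Num.bound _ => yN.
have yN3 : x^-1 + (1 - x)^-1 < N.+3%:R.
  by rewrite (lt_trans yN) // ltr_nat ltnS -addn2 leq_addr.
exists N => //=; rewrite in_itv /=; apply/andP; split.
  rewrite -[leRHS]invrK lef_pV2 ?posrE ?invr_gt0 //.
  by apply/ltW/(le_lt_trans _ yN3); rewrite lerDl invr_ge0 ltW.
rewrite lerBrDr addrC -lerBrDr -[leRHS]invrK lef_pV2 ?posrE ?invr_gt0 //.
by apply/ltW/(le_lt_trans _ yN3); rewrite lerDr invr_ge0 ltW.
Qed.

Lemma one_sub_sqr_gt0 x : 0 < x < 1 -> 0 < 1 - x ^+ 2.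
Proof. by move=> /andP[x0 x1]; rewrite subr_gt0 expr_lt1 // ltW. Qed.

Lemma integral_beta_substitution p r : 0 < p -> 0 < r ->
  (\int[mu]_(v in `]0%R, +oo[) (v `^ (p - 1) * (1 + v) `^ (- (p + r)))%:E =
   \int[mu]_(x in `]0%R, 1%R[)
     (2 * (x `^ (2 * p - 1) * (1 - x ^+ 2) `^ (r - 1)))%:E)%E.
Proof.
move=> p0 r0.
(* This is x^2 / (1 - x^2), in a form that makes 1 + F x, monotonicity and the derivative [f]
   immediate. *)
pose F x : R := (1 - x ^+ 2)^-1 - 1.
pose f x : R := 2 * x * (1 - x ^+ 2) ^- 2.
have I01 x : `]0, 1[%classic x -> 0 < x < 1 by rewrite /= in_itv.
have FE x : 0 < x < 1 -> F x = x ^+ 2 / (1 - x ^+ 2).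
  by move=> /one_sub_sqr_gt0 /lt0r_neq0 x0; rewrite /F; field.
have F_gt0 x : 0 < x < 1 -> 0 < F x.
  move=> x01; rewrite FE // divr_gt0 ?one_sub_sqr_gt0 // exprn_gt0 //.
  by case/andP: x01.
have F_lt x y : 0 < x < 1 -> 0 < y < 1 -> x < y -> F x < F y.
  move=> x01 y01 xy; rewrite /F ltrD2r ltf_pV2 ?posrE ?one_sub_sqr_gt0 //.
  rewrite ltrD2l ltrN2 ltr_pXn2r // nnegrE.
    by case/andP: x01 => /ltW.
  by case/andP: y01 => /ltW.
transitivity (\int[mu]_(x in `]0%R, 1%R[)
    (F x `^ (p - 1) * (1 + F x) `^ (- (p + r)) * f x)%:E)%E; last first.
  apply: eq_integral => x; rewrite inE => /I01 x01; congr EFin.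
  have w0 := one_sub_sqr_gt0 x01; have [x0 x1] := andP x01.
  have -> : 1 + F x = (1 - x ^+ 2)^-1 by rewrite /F addrC subrK.
  (* Every factor is written as an exponential in ln x and ln (1 - x^2), so the identity of powers
     becomes a linear one between exponents. *)
  have -> : f x = 2 * expR (ln x - 2 * ln (1 - x ^+ 2)).
    rewrite expRB /f lnK ?posrE // mulrA; congr (_ * _).
    by rewrite expRM_natl lnK ?posrE.
  have -> : F x = expR (2 * ln x - ln (1 - x ^+ 2)).
    by rewrite FE // expRB expRM_natl !lnK ?posrE.
  rewrite (powR_expR _ (expR_gt0 _)) expRK.
  rewrite powR_expR ?invr_gt0 // lnV ?posrE // !powR_expR //.
  by rewrite mulrCA -!expRD; congr (_ * expR _); ring.
apply: (@ge0_integration_by_substitution_exhaustion R F f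
  (fun v => v `^ (p - 1) * (1 + v) `^ (- (p + r))) (fun n => n.+3%:R^-1)
  (fun n => 1 - n.+3%:R^-1) `]0, 1[%classic `]0, +oo[%classic).
- move=> n; have : n.+3%:R^-1 <= 3^-1 :> R by rewrite lef_pV2 ?posrE // ler_nat.
  by move: (n.+3%:R^-1) => u u3; lra.
- by move=> m n mn; rewrite lef_pV2 ?posrE // ler_nat.
- by move=> m n mn; rewrite lerD2l lerN2 lef_pV2 ?posrE // ler_nat.
- exact: bigcup_itv_01.
- have an n : 0 < (n.+3%:R^-1 : R) < 1.
    by rewrite invr_gt0 ltr0n invf_lt1 // ltr1n.
  have bn n : 0 < (1 - n.+3%:R^-1 : R) < 1.
    by have /andP[? ?] := an n; rewrite subr_gt0 ltrBlDr ltrDl; apply/andP.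
  apply/seteqP; split => y /=.
    move=> [n _ /=]; rewrite !in_itv /= andbT => /andP[+ _].
    exact/lt_le_trans/F_gt0.
  rewrite in_itv /= andbT => y0.
  have y1 : 0 < 1 + y by rewrite addr_gt0.
  (* The preimage of y under [F]; the segment that contains it is mapped to one that contains y. *)
  pose x := Num.sqrt (y / (1 + y)).
  have x2 : x ^+ 2 = y / (1 + y) by rewrite sqr_sqrtr // divr_ge0 // ltW.
  have x01 : 0 < x < 1.
    rewrite sqrtr_gt0 divr_gt0 //= -[ltRHS]sqrtr1 ltr_sqrt //.
    by rewrite ltr_pdivrMr // mul1r ltrDr.
  have FxE : F x = y.
    by rewrite /F x2; field; rewrite addrK oner_neq0 /= gt_eqF.
  have : `]0, 1[%classic x by rewrite /= in_itv.
  rewrite -bigcup_itv_01 => -[n _ /=]; rewrite in_itv /= => /andP[nx xn].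
  have leF u v : 0 < u < 1 -> 0 < v < 1 -> u <= v -> F u <= F v.
    move=> u0 v0; rewrite le_eqVlt => /predU1P[->//|uv].
    exact/ltW/F_lt.
  by exists n => //=; rewrite in_itv /= -FxE !leF.
- by move=> x y; rewrite !inE => /I01 x01 /I01 y01; exact: F_lt.
- move=> x /I01 x01; have w0 := lt0r_neq0 (one_sub_sqr_gt0 x01).
  have dw : is_derive x 1 (fun x => 1 - x ^+ 2) (- (2 * x)).
    by apply: is_derive_eq; rewrite /GRing.scale /= ; ring.
  have dV := @is_deriveV R (fun x => 1 - x ^+ 2) x _ _ w0 dw.
  by apply: is_derive_eq; rewrite /f /GRing.scale /= -exprVn; ring.
- move=> x /I01 x01; have w0 := lt0r_neq0 (one_sub_sqr_gt0 x01).
  apply: cvgM; first by apply: cvgM; [exact: cvg_cst|exact: cvg_id].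
  apply: cvgV; first by rewrite expf_neq0.
  apply: (@continuous_comp _ _ _ (fun x : R => 1 - x ^+ 2) (fun x => x ^+ 2)).
    by apply: cvgB; [exact: cvg_cst|exact: exprn_continuous].
  exact: exprn_continuous.
- move=> x /I01 /[dup] /one_sub_sqr_gt0 w0 /andP[x0 _].
  by rewrite mulr_ge0 ?invr_ge0 ?exprn_ge0 // ?mulr_ge0 // ltW.
- move=> y /=; rewrite in_itv /= andbT => y0.
  apply: cvgM; first exact: continuous_powR_gt0.
  apply: (@continuous_comp _ _ _ (fun y : R => 1 + y) (fun x => x `^ (- (p + r)))).
    by apply: cvgD; [exact: cvg_cst|exact: cvg_id].
  by apply: continuous_powR_gt0; rewrite addr_gt0.
- by move=> y _; rewrite mulr_ge0 ?powR_ge0.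
Qed.

Lemma integral_beta p r : 0 < p -> 0 < r ->
  (\int[mu]_(x in `]0%R, 1%R[)
     (2 * (x `^ (2 * p - 1) * (1 - x ^+ 2) `^ (r - 1)))%:E =
   (Gamma p * Gamma r / Gamma (p + r))%:E)%E.
Proof.
move=> p0 r0; have := eGammaM p0 r0.
rewrite integral_beta_substitution // -!GammaE ?addr_gt0 //.
have G0 := Gamma_gt0 (addr_gt0 p0 r0).
set J := (\int[mu]_(x in _) _)%E => JE.
have J0 : (0 <= J)%E.
  by apply: integral_ge0 => x _; rewrite lee_fin mulr_ge0 ?mulr_ge0 ?powR_ge0.
(* J is not infinite: multiplied by Gamma(p + r) > 0 it equals the finite product of Gamma(p) and
   Gamma(r). *)
move: J J0 JE => [j| |] //= j0; last by rewrite gt0_muley ?lte_fin.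
rewrite -!EFinM => -[->]; congr EFin; rewrite mulrC mulKf //.
exact: lt0r_neq0.
Qed.

End BetaIntegral.

(** * The weight function *)

Section Weight.
Variable R : realType.
Notation mu := (@lebesgue_measure R).
Implicit Types (alpha beta x : R) (k n : nat) (g : R -> R).

(** Lebesgue measure is its own image under the reflection. *)
Lemma ge0_integral_itv_reflect g (a b : R) : measurable_fun setT g ->
  (forall x, 0 <= g x) ->
  (\int[mu]_(x in `]a, b[) (g x)%:E =
   \int[mu]_(x in `](- b)%R, (- a)%R[) (g (- x)%R)%:E)%E.
Proof.
move=> mg g0.
rewrite (_ : `](- b)%R, (- a)%R[%classic =
    (-%R : _ -> measurableTypeR R) @^-1` `]a, b[); last first.
  by rewrite opp_preimage_itvbndbnd.
transitivity (\int[pushforward mu (-%R : _ -> measurableTypeR R)]_(x in `]a, b[)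
    (g x)%:E)%E.
  by apply: eq_measure_integral => A mA _; exact/esym/lebesgue_measureN.
rewrite ge0_integral_pushforward //; last by move=> x _; rewrite lee_fin.
by apply: measurable_funTS; exact/measurable_EFinP.
Qed.

Lemma ge0_integral_even g : measurable_fun setT g ->
  (forall x, 0 <= g x) -> (forall x, g (- x) = g x) ->
  (\int[mu]_(x in `[(-1)%R, 1%R]) (g x)%:E =
   \int[mu]_(x in `]0%R, 1%R[) (2 * g x)%:E)%E.
Proof.
move=> mg g0 ge.
have mE (D : set R) : measurable_fun D (fun x => (g x)%:E).
  by apply: measurable_funTS; exact/measurable_EFinP.
have -> : (`[-1, 1] = `[-1, 0] `|` `]0, 1] :> set R)%classic.
  by rewrite -itv_bndbnd_setU //; rewrite bnd_simp; lra.
rewrite ge0_integral_setU //; first last.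
- rewrite disj_set2E; apply/eqP; rewrite -subset0 => x [] /=.
  by rewrite !in_itv /= => /andP[_ x0] /andP[/(le_lt_trans x0)]; rewrite ltxx.
- by move=> x _; rewrite lee_fin.
- exact: mE.
rewrite (@integral_itv_bndoo R (-1) 0) // (@integral_itv_bndoo R 0 1) //.
rewrite [X in (X + _)%E](_ : _ = \int[mu]_(x in `]0%R, 1%R[) (g x)%:E)%E.
  rewrite -ge0_integralD //; do ?[exact: mE | by move=> x _; rewrite lee_fin].
  by apply: eq_integral => x _; rewrite -EFinD; congr EFin; ring.
rewrite ge0_integral_itv_reflect // oppr0 opprK.
by apply: eq_integral => x _; rewrite ge.
Qed.

(** Reflection makes the integral equal to its own opposite. The integrand changes sign, so
    integrability is what justifies this change of variables. *)
Lemma Rintegral_odd g : measurable_fun setT g ->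
  mu.-integrable `[-1, 1] (EFin \o g) ->
  (forall x, g (- x) = - g x) -> \int[mu]_(x in `[(-1)%R, 1%R]) g x = 0.
Proof.
move=> mg ig go.
have pre : (-%R : _ -> measurableTypeR R) @^-1` `[-1, 1] = `[-1, 1]%classic.
  by rewrite opp_preimage_itvbndbnd opprK.
have gN : EFin \o g \o -%R = -%E \o (EFin \o g).
  by apply/funext => x /=; rewrite go.
have h : (\int[mu]_(x in `[(-1)%R, 1%R]) (g x)%:E =
    \int[mu]_(x in `[(-1)%R, 1%R]) (- g x)%:E)%E.
  transitivity (\int[pushforward mu (-%R : _ -> measurableTypeR R)]_(x in
    `[(-1)%R, 1%R]) (g x)%:E)%E.
    by apply: eq_measure_integral => A mA _; exact/esym/lebesgue_measureN.
  rewrite integral_pushforward // ?pre.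
  - by apply: eq_integral => x _ /=; rewrite go.
  - exact/measurable_EFinP.
  - by rewrite gN; exact: integrableN.
have : \int[mu]_(x in `[(-1)%R, 1%R]) g x = \int[mu]_(x in `[(-1)%R, 1%R]) (- g x).
  by congr fine.
rewrite (_ : \int[mu]_(x in `[(-1)%R, 1%R]) (- g x) =
    - \int[mu]_(x in `[(-1)%R, 1%R]) g x).
  by move/eqP; rewrite -addr_eq0 -mulr2n mulrn_eq0 /= => /eqP.
by rewrite -[RHS]mulN1r -RintegralZl //; apply: eq_Rintegral => x _; rewrite mulN1r.
Qed.

(** The weight without kappa and the factor 1 + x; what remains is even, so its odd moments
    vanish. *)
Definition even_weight alpha beta x : R :=
  `|x| `^ alpha * (1 - x ^+ 2) `^ ((beta - 1) / 2).

Lemma measurable_even_weight alpha beta :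
  measurable_fun setT (even_weight alpha beta).
Proof.
apply: measurable_funM.
  by apply: measurableT_comp (measurable_powR _) _; exact: normr_measurable.
apply: measurableT_comp (measurable_powR _) _.
by apply: measurable_funB => //; exact: exprn_measurable.
Qed.

Lemma even_weight_ge0 alpha beta x : 0 <= even_weight alpha beta x.
Proof. by rewrite mulr_ge0 ?powR_ge0. Qed.

Lemma even_weightN alpha beta x :
  even_weight alpha beta (- x) = even_weight alpha beta x.
Proof. by rewrite /even_weight normrN sqrrN. Qed.

Lemma measurable_monomial_even_weight alpha beta k :
  measurable_fun setT (fun x => x ^+ k * even_weight alpha beta x).
Proof.
by apply: measurable_funM; [exact: exprn_measurable|exact: measurable_even_weight].
Qed.

Lemma Gamma_pochhammer (x : R) n : 0 < x ->
  Gamma (x + n%:R) = pochhammer x n * Gamma x.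
Proof.
move=> x0; elim: n => [|n IHn].
  by rewrite addr0 /pochhammer big_ord0 mul1r.
have -> : x + n.+1%:R = x + n%:R + 1 by rewrite -natr1 addrA.
have xn0 : 0 < x + n%:R by rewrite ltr_wpDr.
rewrite (GammaS xn0) IHn pochhammerS.
move: (pochhammer x n) (Gamma x) => P G.
by rewrite mulrCA mulrA.
Qed.

(** The beta integral with p = alpha / 2 + 1 / 2 + n and r = beta / 2 + 1 / 2. Its value at n = 0 is
    1 / kappa, and the shift of p by n produces the two Pochhammer symbols. *)
Lemma integral_monomial_even_weight alpha beta n : -1 < alpha -> -1 < beta ->
  (\int[mu]_(x in `[(-1)%R, 1%R]) (x ^+ n.*2 * even_weight alpha beta x)%:E
   = (jacobi_moment alpha beta n.*2 / kappa alpha beta)%:E)%E.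
Proof.
move=> halpha hbeta.
have p0 : 0 < alpha / 2 + 1 / 2 by lra.
have r0 : 0 < beta / 2 + 1 / 2 by lra.
rewrite ge0_integral_even; first last.
- by move=> x; rewrite even_weightN -mul2n exprM sqrrN -exprM.
- by move=> x; rewrite mulr_ge0 ?even_weight_ge0 // -mul2n exprM exprn_ge0 ?sqr_ge0.
- exact: measurable_monomial_even_weight.
have pn0 : 0 < alpha / 2 + 1 / 2 + n%:R by rewrite ltr_wpDr.
transitivity (\int[mu]_(x in `]0%R, 1%R[)
  (2 * (x `^ (2 * (alpha / 2 + 1 / 2 + n%:R) - 1)
    * (1 - x ^+ 2) `^ (beta / 2 + 1 / 2 - 1)))%:E)%E.
  apply: eq_integral => x; rewrite inE /= in_itv /= => /andP[x0 x1].
  rewrite /even_weight gtr0_norm // -(powR_mulrn n.*2 (ltW x0)).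
  rewrite [x `^ _ * _]mulrA -powRD ?(gt_eqF x0) ?implybT //.
  congr (2 * (_ `^ _ * _ `^ _))%:E.
    by rewrite -mul2n natrM; field.
  by field.
rewrite integral_beta //; congr EFin.
rewrite Gamma_pochhammer // addrAC.
have s0 : 0 < alpha / 2 + 1 / 2 + (beta / 2 + 1 / 2) by rewrite addr_gt0.
rewrite Gamma_pochhammer // /jacobi_moment uphalf_double /kappa.
have -> : alpha / 2 + beta / 2 + 1 = alpha / 2 + 1 / 2 + (beta / 2 + 1 / 2) by field.
have Gs := lt0r_neq0 (Gamma_gt0 s0).
have Gp := lt0r_neq0 (Gamma_gt0 p0).
have Gr := lt0r_neq0 (Gamma_gt0 r0).
have Ps := lt0r_neq0 (pochhammer_gt0 n s0).
move: Gs Gp Gr Ps.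
move: (pochhammer _ _) (pochhammer _ _) (Gamma _) (Gamma _) (Gamma _).
move=> P' P G3 G2 G1 G30 G10 G20 P0.
by field; rewrite P0 G10 G20 G30.
Qed.

Lemma kappa_gt0 alpha beta : -1 < alpha -> -1 < beta -> 0 < kappa alpha beta.
Proof.
by move=> ? ?; rewrite divr_gt0 ?mulr_gt0 ?Gamma_gt0 //; lra.
Qed.

(** On the interval |x^k| <= 1, so the case k = 0 dominates; there the integrand is nonnegative and
    its integral has just been computed to be finite. *)
Lemma integrable_monomial_even_weight alpha beta k : -1 < alpha -> -1 < beta ->
  mu.-integrable `[-1, 1] (EFin \o (fun x => x ^+ k * even_weight alpha beta x)).
Proof.
move=> halpha hbeta.
have mE j : measurable_fun (`[-1, 1]%classic : set R)
    (EFin \o (fun x => x ^+ j * even_weight alpha beta x)).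
  apply/measurable_EFinP; apply: measurable_funTS.
  exact: measurable_monomial_even_weight.
have le_norm x : x \in `[-1, 1] -> (`|(x ^+ k * even_weight alpha beta x)%:E| <=
    `|(x ^+ 0 * even_weight alpha beta x)%:E|)%E.
  rewrite in_itv /= -ler_norml => x1.
  rewrite lee_fin !normrM expr0 normr1 normrX ler_wpM2r //.
  exact: exprn_ile1.
apply: (@le_integrable _ _ R mu _ _ _
  (EFin \o (fun x => x ^+ 0 * even_weight alpha beta x))) => //;
  first exact: mE.
apply/integrableP; split; first exact: mE.
apply: (@le_lt_trans _ _ (jacobi_moment alpha beta 0.*2 / kappa alpha beta)%:E);
  last by rewrite ltry.
rewrite -integral_monomial_even_weight // le_eqVlt; apply/orP; left; apply/eqP.
apply: eq_integral => x _ /=.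
by rewrite ger0_norm // expr0 mul1r even_weight_ge0.
Qed.

(** Exactly one of k and k + 1 is even, so exactly one of the two terms contributes to the moment;
    this is the source of c_(2n) = c_(2n-1). *)
Lemma weightE alpha beta x k : x ^+ k * weight alpha beta x =
  kappa alpha beta * (x ^+ k * even_weight alpha beta x
    + x ^+ k.+1 * even_weight alpha beta x).
Proof. by rewrite /weight /even_weight [x ^+ k.+1]exprS; ring. Qed.

Lemma integrable_monomial_weight alpha beta k : -1 < alpha -> -1 < beta ->
  mu.-integrable `[-1, 1] (EFin \o (fun x => x ^+ k * weight alpha beta x)).
Proof.
move=> halpha hbeta; have ie j := integrable_monomial_even_weight j halpha hbeta.
rewrite (_ : EFin \o _ = fun x => ((kappa alpha beta)%:E *
    ((EFin \o (fun x => x ^+ k * even_weight alpha beta x)%R) x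
     + (EFin \o (fun x => x ^+ k.+1 * even_weight alpha beta x)%R) x))%E).
  by apply: integrableZl => //; apply: integrableD.
by apply/funext => x /=; rewrite weightE.
Qed.

Lemma moment_weight alpha beta k : -1 < alpha -> -1 < beta ->
  \int[mu]_(x in `[(-1)%R, 1%R]) (x ^+ k * weight alpha beta x)
  = jacobi_moment alpha beta k.
Proof.
move=> halpha hbeta.
have k0 := lt0r_neq0 (kappa_gt0 halpha hbeta).
have even n : \int[mu]_(x in `[(-1)%R, 1%R]) (x ^+ n.*2 * even_weight alpha beta x)
    = jacobi_moment alpha beta n.*2 / kappa alpha beta.
  by rewrite /Rintegral integral_monomial_even_weight.
have odd n :
    \int[mu]_(x in `[(-1)%R, 1%R]) (x ^+ n.*2.+1 * even_weight alpha beta x) = 0.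
  apply: Rintegral_odd.
  - exact: measurable_monomial_even_weight.
  - exact: integrable_monomial_even_weight.
  - move=> x; rewrite even_weightN exprNn -signr_odd /= odd_double expr1.
    by rewrite mulN1r mulNr.
under eq_Rintegral do rewrite weightE.
rewrite RintegralZl //; last first.
  rewrite (_ : EFin \o _ =
    (EFin \o (fun x => x ^+ k * even_weight alpha beta x)%R)
     \+ (EFin \o (fun x => x ^+ k.+1 * even_weight alpha beta x)%R))%E //.
  by apply: integrableD => //; exact: integrable_monomial_even_weight.
rewrite RintegralD //; do ?exact: integrable_monomial_even_weight.
rewrite -(odd_double_half k); case: (ssrnat.odd k); rewrite /= ?add0n ?add1n.
  rewrite odd add0r -doubleS even mulrC divfK //.
  by rewrite /jacobi_moment /= uphalf_double doubleK.
by rewrite odd addr0 even mulrC divfK.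
Qed.

Lemma horner_weightE (f : {poly R}) alpha beta x :
  f.[x] * weight alpha beta x =
  \sum_(i < size f) f`_i * (x ^+ i * weight alpha beta x).
Proof.
by rewrite horner_coef mulr_suml; apply: eq_bigr => i _; rewrite -mulrA.
Qed.

Lemma integrable_horner_weight (f : {poly R}) alpha beta :
  -1 < alpha -> -1 < beta ->
  mu.-integrable `[-1, 1] (EFin \o (fun x => f.[x] * weight alpha beta x)).
Proof.
move=> halpha hbeta.
rewrite (_ : EFin \o _ = fun x =>
  (\sum_(i < size f) (f`_i)%:E * (x ^+ i * weight alpha beta x)%:E)%E); last first.
  by apply/funext => x /=; rewrite horner_weightE -sumEFin.
apply: integrable_sum => // i _; apply: integrableZl => //.
exact: integrable_monomial_weight.
Qed.

Definition jacobi_functional alpha beta (f : {poly R}) : R :=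
  \int[mu]_(x in `[(-1)%R, 1%R]) (f.[x] * weight alpha beta x).

Lemma jacobi_functional_is_scalar alpha beta : -1 < alpha -> -1 < beta ->
  scalar (jacobi_functional alpha beta).
Proof.
move=> halpha hbeta c f g; rewrite /jacobi_functional.
have i1 := @integrable_horner_weight f alpha beta halpha hbeta.
have i2 := @integrable_horner_weight g alpha beta halpha hbeta.
have mI : measurable (`[-1, 1]%classic : set R) by [].
rewrite -RintegralZl // -RintegralD //.
  by apply: eq_Rintegral => x _; rewrite hornerD hornerZ mulrDl -mulrA.
rewrite (_ : EFin \o _ = fun x =>
  (c%:E * (EFin \o (fun x => f.[x] * weight alpha beta x)%R) x)%E) //.
exact: integrableZl.
Qed.

End Weight.

Theorem mainTheorem1 (R : realType) (alpha beta : R)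
    (halpha : -1 < alpha) (hbeta : -1 < beta) :
  ((forall n : nat, (1 <= n)%N ->
      qJacobi_u (q_ eps) (a_ alpha eps) (b_ beta eps) n @[eps --> (0 : R)^']
        --> jacobi_u alpha beta n) /\
   (forall n : nat,
      qJacobi_b (q_ eps) (a_ alpha eps) (b_ beta eps) n @[eps --> (0 : R)^']
        --> jacobi_b alpha beta n))
  /\
  (orthogonal_wrt `[-1, 1] (weight alpha beta) (jacobiP alpha beta) /\
   has_moment `[-1, 1] (weight alpha beta) 0%N 1 /\
   (forall n : nat, (1 <= n)%N ->
      let c := pochhammer (alpha / 2 + 1 / 2) n
               / pochhammer (alpha / 2 + beta / 2 + 1) n in
      has_moment `[-1, 1] (weight alpha beta) (2 * n)%N c /\
      has_moment `[-1, 1] (weight alpha beta) (2 * n - 1)%N c))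
  /\
  (forall (f : {poly R}) (k : nat),
      (eps^-1 *: qJacobi_op (q_ eps) (a_ alpha eps) (b_ beta eps) f)`_k
        @[eps --> (0 : R)^'] --> (L0 alpha beta f)`_k).
Proof.
have moment k : has_moment `[-1, 1] (weight alpha beta) k (jacobi_moment alpha beta k).
  by split; [exact: integrable_monomial_weight|exact: moment_weight].
split; [split|split; [split; [|split]|]].
- move=> n n1; rewrite jacobi_uE //.
  by apply: cvgM; [exact: cvg_qJacobiA|exact: cvg_qJacobiC].
- move=> n; rewrite jacobi_bE //.
  by apply: cvgD; [exact: cvg_qJacobiA|exact: cvg_qJacobiC].
(* Integration against the weight, bundled as a linear functional so that the algebraic
   orthogonality applies to it. *)
- pose L : {scalar {poly R}} := HB.pack (jacobi_functional alpha beta)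
    (GRing.isLinear.Build R {poly R} R *%R (jacobi_functional alpha beta)
       (jacobi_functional_is_scalar halpha hbeta)).
  have LX k : L 'X^k = jacobi_moment alpha beta k.
    rewrite -moment_weight //; apply: eq_Rintegral => x _.
    by rewrite hornerXn.
  have LP m n : \int[@lebesgue_measure R]_(x in `[-1, 1])
      ((jacobiP alpha beta m).[x] * (jacobiP alpha beta n).[x]
        * weight alpha beta x) = L (jacobiP alpha beta m * jacobiP alpha beta n).
    by apply: eq_Rintegral => x _; rewrite hornerM.
  split.
  + move=> m n.
    have := integrable_horner_weight (jacobiP alpha beta m * jacobiP alpha beta n)
      halpha hbeta.
    by rewrite (_ : (fun x => _) = fun x => (jacobiP alpha beta m).[x]
      * (jacobiP alpha beta n).[x] * weight alpha beta x) //;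
      apply/funext => x; rewrite hornerM.
  (* The polynomial of smaller degree is the one to expand; the other order follows by commutativity
     of the product. *)
  + move=> m n mn; rewrite LP; case: (ltnP m n) => [/ltnW|] le_mn.
      by rewrite functional_jacobiP_ltn // (negbTE mn).
    by rewrite mulrC functional_jacobiP_ltn // eq_sym (negbTE mn).
  + move=> n; rewrite LP functional_jacobiP_ltn // eqxx.
    exact: mixed_moment_gt0.
- by have := moment 0%N; rewrite jacobi_moment0.
- move=> n n1 c.
  have e1 : jacobi_moment alpha beta (2 * n) = c.
    by rewrite /jacobi_moment mul2n uphalf_double.
  have e2 : jacobi_moment alpha beta (2 * n - 1) = c.
    case: n n1 @c {e1} => // n _.
    by rewrite mul2n doubleS subn1 /jacobi_moment /= doubleK.
  by split; [rewrite -e1|rewrite -e2]; exact: moment.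
- exact: cvg_qJacobi_op.
Qed.
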